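(* Let $\mathcal{M}=\langle\mathcal{X},X_W,\Phi,\mathcal{B}\rangle$ be a system of constraints with $\mathcal{B}=\langle V,F,E\rangle$, and let $g:\mathcal{X}_W\to\mathcal{X}_{V\setminus W}$ be a solution of $\mathcal{M}$; let $X^*$ denote the random vector with $X^*_w=X_w$ ($w\in W$) and $X^*_{V\setminus W}=g(X_W)$. Suppose the subgraph of $\mathcal{B}$ induced by $(V\cup F)\setminus W$ has a perfect matching $M$. If for each strongly connected component $S$ of $\mathcal{G}(\mathcal{B},M)$ with $S\cap W=\emptyset$ the system $\mathcal{M}$ is uniquely solvable w.r.t. $S_F=(S\cup M(S))\cap F$ and $S_V=(S\cup M(S))\cap V$, then the pair $(\mathcal{G}(\mathcal{B},M)_{\mathrm{mar}(F)},\mathbb{P}_{X^*})$ satisfies the generalized directed global Markov property: for all subsets $A,B,C\subseteq V$, if $A$ and $B$ are $\sigma$-separated by $C$ in $\mathcal{G}(\mathcal{B},M)_{\mathrm{mar}(F)}$, then $X^*_A$ is independent of $X^*_B$ given $X^*_C$.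
   Context: System of constraints $\langle\mathcal{X},X_W,\Phi,\mathcal{B}\rangle$: $\mathcal{X}=\bigotimes_{v\in V}\mathcal{X}_v$, each $\mathcal{X}_v$ a standard measurable space; $W\subseteq V$ and $X_W=(X_w)_{w\in W}$ independent random variables; $\Phi=(\Phi_f)_{f\in F}$ with $\Phi_f=\langle\phi_f,c_f,V(f)\rangle$, $V(f)\subseteq V$, $c_f$ a constant in a standard measurable space $\mathcal{Y}$, $\phi_f:\mathcal{X}_{V(f)}\to\mathcal{Y}$ measurable; $\mathcal{B}=\langle V,F,E\rangle$ bipartite with $E=\{(f-v):v\in V(f)\}$; $V(S_F)=\bigcup_{f\in S_F}V(f)$. A solution is a measurable $g:\mathcal{X}_W\to\mathcal{X}_{V\setminus W}$ with $\phi_f(g_{V(f)\setminus W}(X_W),X_{V(f)\cap W})=c_f$ for all $f\in F$ a.s. $\mathcal{M}$ is uniquely solvable w.r.t. $S_F\subseteq F$ and $S_V\subseteq V(S_F)\setminus W$ if there is a measurable $g_{S_V}:\mathcal{X}_{V(S_F)\setminus S_V}\to\mathcal{X}_{S_V}$ such that, $\mathbb{P}_{X_W}$-a.s., for all $x_{V(S_F)\setminus W}$: $\phi_f(x_{V(f)\setminus W},X_{V(f)\cap W})=c_f$ for all $f\in S_F$ if and only if $x_{S_V}=g_{S_V}(x_{V(S_F)\setminus(S_V\cup W)},X_{V(S_F)\cap W})$. For a matching $M$ and vertex set $X$, $M(X)$ is the set of vertices matched to vertices of $X$. $\mathcal{G}(\mathcal{B},M)$ is the directed graph on $V\cup F$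 containing, for each $(v-f)\in E$, the edge $f\to v$ if $(v-f)\in M$ and $v\to f$ otherwise. For a directed graph and a set $U$ of vertices, the marginalization $\mathcal{G}_{\mathrm{mar}(U)}$ is the directed mixed graph on the remaining vertices with $x\to y$ iff there is a directed path from $x$ to $y$ all of whose intermediate vertices lie in $U$, and $x\leftrightarrow y$ iff there is a path $x\leftarrow u_1\leftarrow\dots\leftarrow u_i\to\dots\to u_k\to y$ with all $u_j\in U$. $\sigma$-separation in a directed mixed graph $\mathcal{G}$: paths are sequences of distinct vertices joined by edges $\to,\leftarrow,\leftrightarrow$; $\mathrm{an}(Z)$ is the set of vertices with a directed path (possibly trivial) into $Z$; $\mathrm{sc}(v)$ is the strongly connected component of $v$ (vertices that are both ancestors and descendants of $v$). A path $(v_1,\dots,v_n)$ is $\sigma$-blocked by $Z$ if (1) $v_1\in Z$ or $v_n\in Z$, or (2) some $v_i\notin\mathrm{an}(Z)$ has arrowheads of both adjacent path edges at $v_i$, or (3) some $v_i\in Z$ has $v_i\to v_{i+1}$ on the path with $v_{i+1}\notin\mathrm{sc}(v_i)$, or $v_{i-1}\leftarrow v_i$ with $v_{i-1}\notin\mathrm{sc}(v_i)$. $A$ and $B$ are $\sigma$-separated by $C$ if every path with one endpoint in $A$ and the other in $B$ is $\sigma$-blocked by $C$. *)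

(* Defs.v *)
From HB Require Import structures.
From mathcomp Require Import all_boot all_order all_algebra.
From mathcomp Require Import all_classical all_reals all_analysis.
From Stdlib Require Import Relation_Operators.
Set Implicit Arguments.
Unset Strict Implicit.
Unset Printing Implicit Defensive.
Import Order.TTheory GRing.Theory Num.Theory.
Local Open Scope classical_set_scope.
Local Open Scope ring_scope.

(* A measurable space is standard iff it is Borel-isomorphic to a Borel *)
(* subset of a Polish space; by Kuratowski's theorem, equivalently to a *)
(* Borel subset of the real line.                         *)
Definition standard_msp (R : realType) (d : measure_display)
  (T : measurableType d) : Prop :=
  exists f : T -> R,
    [/\ injective f, measurable_fun setT f &
        forall A : set T, measurable A -> measurable (f @` A)].

Section Product.
Variables (V : finType) (d : V -> measure_display)
          (T : forall v, measurableType (d v)).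

Definition config := forall v : V, T v.

(* sigma-algebra on X generated by the coordinates in U, i.e. the events *)
(* of the form {x | x_U in B}, B measurable in X_U.                       *)
Definition coord_sigma (U : {set V}) : set (set config) :=
  <<s [set S : set config | exists2 v : V, v \in U &
          exists2 B : set (T v), measurable B &
            S = (fun x : config => x v) @^-1` B] >>.
End Product.
Arguments coord_sigma {V d} T U.

(* f : X -> Y is measurable w.r.t. the coordinates in U (i.e. it is a    *)
(* measurable function of x_U).                                          *)
Definition coord_measurable (V : finType) (d : V -> measure_display)
  (T : forall v, measurableType (d v)) (U : {set V})
  (dY : measure_display) (Y : measurableType dY) (h : config T -> Y) : Prop :=
  forall B : set Y, measurable B -> coord_sigma T U (h @^-1` B).

Section Graphs.
Variables (V F : finType) (Vf : F -> {set V}) (W : {set V}) (M : {set V * F}).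
(* The bipartite graph B = <V, F, E> has the edge (v - f) iff v \in V(f). *)

Definition perfect_matching : Prop :=
  [/\ forall v f, (v, f) \in M -> (v \in Vf f) && (v \notin W),
      forall v, v \notin W -> #|[set f | (v, f) \in M]| = 1 &
      forall f, #|[set v | (v, f) \in M]| = 1].

Definition GBM : rel (V + F) := fun a b =>
  match a, b with
  | inl v, inr f => (v \in Vf f) && ((v, f) \notin M)
  | inr f, inl v => (v \in Vf f) && ((v, f) \in M)
  | _, _ => false
  end.

Definition matched (a b : V + F) : bool :=
  match a, b with
  | inl v, inr f => (v, f) \in M
  | inr f, inl v => (v, f) \in M
  | _, _ => false
  end.

Definition scc (a : V + F) : {set V + F} :=
  [set b | connect GBM a b && connect GBM b a].

Definition matchedset (S : {set V + F}) : {set V + F} :=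
  [set b | [exists a in S, matched a b]].

Definition SF_of (S : {set V + F}) : {set F} :=
  [set f | inr f \in S :|: matchedset S].
Definition SV_of (S : {set V + F}) : {set V} :=
  [set v | inl v \in S :|: matchedset S].

Definition F_nodes : {set V + F} := [set a | if a is inr _ then true else false].
End Graphs.

Section Marginalization.
Variables (N : finType) (e : rel N) (U : {set N}).
Definition mar_dir (x y : N) : Prop :=
  exists q : seq N, path e x (rcons q y) /\ all (fun u => u \in U) q.
Definition mar_bi (x y : N) : Prop :=
  exists2 u, u \in U & mar_dir u x /\ mar_dir u y.
End Marginalization.

Inductive ekind := EFwd | EBwd | EBi.

Section SigmaSep.
Variables (N : finType) (dir : N -> N -> Prop) (bi : N -> N -> Prop).

Definition edge_ok (x : N) (k : ekind) (y : N) : Prop :=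
  match k with EFwd => dir x y | EBwd => dir y x | EBi => bi x y end.

Definition mpath (x : N) (vs : seq N) (ks : seq ekind) : Prop :=
  [/\ uniq (x :: vs), size ks = size vs &
      forall i, (i < size vs)%N ->
        edge_ok (nth x (x :: vs) i) (nth EBi ks i) (nth x (x :: vs) i.+1)].

Definition dreach (x y : N) : Prop := clos_refl_trans N dir x y.
Definition anc (Z : {set N}) (y : N) : Prop := exists2 z, z \in Z & dreach y z.
Definition same_sc (x y : N) : Prop := dreach x y /\ dreach y x.

Definition head_at_end (k : ekind) : bool := if k is EBwd then false else true.
Definition head_at_start (k : ekind) : bool := if k is EFwd then false else true.

Definition sigma_blocked (Z : {set N}) (x : N) (vs : seq N) (ks : seq ekind)
  : Prop :=
  let w := x :: vs in
  let n := size w in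
  [\/ x \in Z \/ last x vs \in Z,
      exists i, [/\ (0 < i)%N, (i < n.-1)%N, ~ anc Z (nth x w i),
                    head_at_end (nth EBi ks i.-1) & head_at_start (nth EBi ks i)] |
      exists i, [/\ (i < n)%N, nth x w i \in Z &
        ((i.+1 < n)%N /\ nth EBi ks i = EFwd /\ ~ same_sc (nth x w i) (nth x w i.+1))
        \/ ((0 < i)%N /\ nth EBi ks i.-1 = EBwd /\ ~ same_sc (nth x w i) (nth x w i.-1))]].

Definition sigma_separated (A B C : {set N}) : Prop :=
  forall x vs ks, mpath x vs ks ->
    (x \in A /\ last x vs \in B) \/ (x \in B /\ last x vs \in A) ->
    sigma_blocked C x vs ks.
End SigmaSep.

Section Prob.
Local Open Scope ereal_scope.
Variables (R : realType) (dO : measure_display) (Omega : measurableType dO)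
          (P : probability Omega R).
Variables (V : finType) (d : V -> measure_display)
          (T : forall v, measurableType (d v)).

Definition mutually_independent (W : {set V}) (X : forall v, Omega -> T v)
  : Prop :=
  forall B : forall v, set (T v), (forall v, v \in W -> measurable (B v)) ->
    P (\bigcap_(v in [set v | v \in W]) (X v @^-1` B v)) =
    \prod_(v in W) P (X v @^-1` B v).

(* Y_A is conditionally independent of Y_B given Y_C, for a random vector *)
(* Y with values in X: for all events a of Y_A, b of Y_B there are versions *)
(* ha(Y_C), hb(Y_C) of P(Y_A in a | Y_C), P(Y_B in b | Y_C) whose product   *)
(* is a version of P(Y_A in a, Y_B in b | Y_C).                           *)
Definition cond_indep (Y : Omega -> config T) (A B C : {set V}) : Prop :=
  forall a b, coord_sigma T A a -> coord_sigma T B b ->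
  exists ha hb : config T -> R,
    [/\ forall x, (0 <= ha x <= 1)%R,
        forall x, (0 <= hb x <= 1)%R,
        coord_measurable C ha,
        coord_measurable C hb &
        forall c, coord_sigma T C c ->
          [/\ P (Y @^-1` (a `&` c)) = \int[P]_(w in Y @^-1` c) (ha (Y w))%:E,
              P (Y @^-1` (b `&` c)) = \int[P]_(w in Y @^-1` c) (hb (Y w))%:E &
              P (Y @^-1` (a `&` b `&` c)) =
                \int[P]_(w in Y @^-1` c) (ha (Y w) * hb (Y w))%:E]].

Variables (F : finType) (Vf : F -> {set V}) (W : {set V})
          (X : forall v, Omega -> T v)
          (dY : measure_display) (Y : measurableType dY)
          (phi : F -> config T -> Y) (c : F -> Y).

Definition Xstar (g : forall v, config T -> T v) (w : Omega) : config T :=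
  fun v => if v \in W then X v w else g v (fun u => X u w).

Definition is_solution (g : forall v, config T -> T v) : Prop :=
  (forall v, v \notin W -> coord_measurable W (g v)) /\
  (forall f, {ae P, forall w, phi f (Xstar g w) = c f}).

Definition uniquely_solvable (SF : {set F}) (SV : {set V}) : Prop :=
  let VSF := (\bigcup_(f in SF) Vf f)%SET in
  SV \subset VSF :\: W /\
  exists h : forall v, config T -> T v,
    (forall v, v \in SV -> coord_measurable (VSF :\: SV) (h v)) /\
    {ae P, forall w, forall x : config T,
       let z : config T := fun v => if v \in W then X v w else x v in
       (forall f, f \in SF -> phi f z = c f) <->
       (forall v, v \in SV -> z v = h v z)}.
End Prob.

(* Main.v *)
(** Since every [f] is matched to exactly one variable, two variables of the
marginalized graph are joined by a bidirected edge only if they coincide, so it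
is a directed graph [D] on [V], whose strongly connected components outside [W]
are the sets [S_V] of the solvability assumption.  Evaluating the unique
solvability of a component [S] at the solution shows that [X*_S] is a.s. a
function of the variables in [pa S \ S].  Hence the law of [X*] is built one
component at a time, along a topological order of the components, by adding
either an independent variable [w] in [W] or a deterministic function of the
past, and the Markov property is proved by induction along this order, using
the graphoid properties of conditional independence.

For a deterministic component [S] and a conditioning set [C]: if [S] misses
[C], any vertex of [S] may be replaced by the parents of [S]; if [S] meets
[C], all its vertices are ancestors of [C], so [S] and its parents can be
crossed freely by open walks and can be connected to at most one of [A] and
[B]; on the other side one first adjoins the parents of [S], then [S], and
then conditions on [S :&: C].  Open walks are used instead of
open paths because they can be concatenated. *)

Require Import Defs.
From Stdlib Require Import Relation_Operators Operators_Properties.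
From HB Require Import structures.
From mathcomp Require Import all_boot all_order all_algebra.
From mathcomp Require Import boolp.
Set Implicit Arguments.
Unset Strict Implicit.
Unset Printing Implicit Defensive.

(** * Open walks *)

Section OpenWalks.
Variables (N : finType) (dir : N -> N -> Prop).
Implicit Types (U A B C S : {set N}) (x y z s : N).

Local Notation dreach := (dreach dir).
Local Notation anc := (anc dir).
Local Notation same_sc := (same_sc dir).

Lemma dreach_refl x : dreach x x. Proof. exact: rt_refl. Qed.
Lemma dreach_edge x y : dir x y -> dreach x y. Proof. exact: rt_step. Qed.
Lemma dreach_trans y x z : dreach x y -> dreach y z -> dreach x z.
Proof. exact: rt_trans. Qed.
Hint Resolve dreach_refl : core.

Lemma anc_reach C x y : dreach x y -> anc C y -> anc C x.
Proof. by move=> xy [z zC yz]; exists z => //; exact: dreach_trans yz. Qed.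

Lemma anc_sub C C' x : C \subset C' -> anc C x -> anc C' x.
Proof. by move=> /subsetP CC' [z zC xz]; exists z => //; exact: CC'. Qed.

(* Condition (3) of sigma-blocking constrains single edges, in whichever     *)
(* direction they are traversed, so it can be built into the edge relation. *)
Definition admissible U C x y :=
  [/\ x \in U, y \in U, dir x y & x \in C -> same_sc x y].

(* The boolean records whether the last edge points at the final vertex. *)
Inductive owalk U C x : N -> bool -> Prop :=
| ow_nil : owalk U C x x false
| ow_fwd y b z : owalk U C x y b -> admissible U C y z -> owalk U C x z true
| ow_bwd y b z : owalk U C x y b -> admissible U C z y -> (b -> anc C y) ->
    owalk U C x z false.

(** Endpoints in [C] are left out because condition (1) already blocks them. The empty walk counts,
    so [A] and [B] share no vertex outside [C]. *)
Definition walk_separated U A B C :=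
  forall x y b, x \in A :\: C -> y \in B :\: C -> ~ owalk U C x y b.

(** The new conditioning vertices lie outside [U], so the walk never meets them, and a larger [C]
    only opens more colliders. *)
Lemma owalk_mono U U' C C' x y b : U \subset U' -> C \subset C' ->
  C' :&: U \subset C -> owalk U C x y b -> owalk U' C' x y b.
Proof.
move=> UU' CC' C'U.
have adm u v : admissible U C u v -> admissible U' C' u v.
  case=> uU vU uv uC; split=> //; [exact: (subsetP UU')..|].
  by move=> uC'; apply: uC; apply: (subsetP C'U); rewrite inE uC'.
elim=> [|{}y {}b z _ IH /adm yz|{}y {}b z _ IH /adm yz h].
- exact: ow_nil.
- exact: ow_fwd IH yz.
- by apply: ow_bwd IH yz _ => /h; exact: anc_sub.
Qed.

(** The second walk is appended in reverse, edge by edge. A new collider can only arise at the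
    meeting vertex, when both last edges point at it. *)
Lemma owalk_join U C x x' y b b' : owalk U C x y b -> owalk U C x' y b' ->
  (b && b' -> anc C y) -> exists b'', owalk U C x x' b''.
Proof.
move=> xy x'y; elim: x'y b xy => {y b'} [|y b' z _ IH yz|y b' z _ IH zy b'y] b xz.
- by exists b.
- rewrite andbT => bz; apply: (IH false) => //; exact: ow_bwd xz yz bz.
- by move=> _; apply: (IH true) => //; exact: ow_fwd xz zy.
Qed.

Lemma owalk_sym U C x y b : owalk U C x y b -> exists b', owalk U C y x b'.
Proof. by move=> xy; apply: owalk_join (ow_nil U C y) xy _. Qed.

Lemma walk_separated_sym U A B C :
  walk_separated U A B C -> walk_separated U B A C.
Proof. by move=> sep x y b xB yA /owalk_sym[b']; exact: sep. Qed.



(** * From open walks to open paths *)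

Section ToPath.
Variables (C : {set N}) (x : N).
Local Notation owalkT := (owalk [set: N] C x).
Local Notation adm := (admissible [set: N] C).

(** The default [EBwd] gives the empty path no arrowhead at its end. *)
Definition arrow_in (ks : seq ekind) := if last EBwd ks is EFwd then true else false.

Inductive opath : seq N -> seq ekind -> Prop :=
| op_nil : opath [::] [::]
| op_fwd vs ks z : opath vs ks -> z \notin x :: vs -> adm (last x vs) z ->
    opath (rcons vs z) (rcons ks EFwd)
| op_bwd vs ks z : opath vs ks -> z \notin x :: vs -> adm z (last x vs) ->
    (arrow_in ks -> anc C (last x vs)) -> opath (rcons vs z) (rcons ks EBwd).

(** If the path enters [z] by an arrow, it either continues forward to its end or first turns back
    at a collider, which is a descendant of [z] and an ancestor of [C]. *)
Lemma opath_prefix vs ks z : opath vs ks -> z \in x :: vs ->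
  exists vs' ks', [/\ opath vs' ks', last x vs' = z &
    arrow_in ks' -> anc C z \/ (dreach z (last x vs) /\ arrow_in ks)].
Proof.
move=> p; elim: p z => {vs ks} [|vs ks u p IH ux ad|vs ks u p IH ux ad h] z.
- by rewrite inE => /eqP->; exists [::], [::]; split=> //; exact: op_nil.
- rewrite -rcons_cons mem_rcons inE => /predU1P[->|/IH].
    exists (rcons vs u), (rcons ks EFwd); split; [exact: op_fwd|exact: last_rcons|].
    by move=> a; right; rewrite last_rcons.
  case=> vs' [ks' [p' l a]]; exists vs', ks'; split=> // /a[|[zl _]]; [by left|right].
  rewrite last_rcons /arrow_in last_rcons; split=> //.
  by apply: dreach_trans zl _; apply: dreach_edge; case: ad.
- rewrite -rcons_cons mem_rcons inE => /predU1P[->|/IH].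
    exists (rcons vs u), (rcons ks EBwd); split; [exact: op_bwd|exact: last_rcons|].
    by rewrite /arrow_in last_rcons.
  case=> vs' [ks' [p' l a]]; exists vs', ks'; split=> // /a[|[zl /h]]; [by left|left].
  exact: anc_reach zl _.
Qed.

(** Loop erasure: on returning to a visited vertex, the path is cut back to it. The cut may create
    an arrowhead absent from the walk, but then the end is an ancestor of [C] and a collider there
    stays open. *)
Lemma owalk_opath y b : owalkT y b -> exists vs ks,
  [/\ opath vs ks, last x vs = y & arrow_in ks -> b \/ anc C y].
Proof.
elim=> [|{}y {}b z _ [vs [ks [p l h]]] ad|{}y {}b z _ [vs [ks [p l h]]] ad by_].
- by exists [::], [::]; split=> //; exact: op_nil.
- have [zx|zx] := boolP (z \in x :: vs).
    have [vs' [ks' [p' l' _]]] := opath_prefix p zx.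
    by exists vs', ks'; split=> // _; left.
  exists (rcons vs z), (rcons ks EFwd); split; last by left.
    by apply: op_fwd => //; rewrite l.
  exact: last_rcons.
- have ancy : arrow_in ks -> anc C y by move=> /h[/by_|].
  have [zx|zx] := boolP (z \in x :: vs).
    have [vs' [ks' [p' l' h']]] := opath_prefix p zx.
    exists vs', ks'; split=> // /h'[zC|[_ /ancy yC]]; right=> //.
    by apply: anc_reach yC; apply: dreach_edge; case: ad.
  exists (rcons vs z), (rcons ks EBwd); split; [|exact: last_rcons|].
    by apply: op_bwd => //; rewrite l.
  by rewrite /arrow_in last_rcons.
Qed.

Lemma opath_size vs ks : opath vs ks -> size ks = size vs.
Proof. by elim=> // {}vs {}ks z _ IH *; rewrite !size_rcons IH. Qed.

Lemma opath_uniq vs ks : opath vs ks -> uniq (x :: vs).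
Proof.
elim=> // {}vs {}ks z _ IH zx *;
  by rewrite -rcons_cons rcons_uniq zx IH.
Qed.

Lemma opath_edge vs ks i : opath vs ks -> i < size vs ->
  match nth EBi ks i with
  | EFwd => adm (nth x (x :: vs) i) (nth x (x :: vs) i.+1)
  | EBwd => adm (nth x (x :: vs) i.+1) (nth x (x :: vs) i)
  | EBi => False
  end.
Proof.
move=> p; elim: p i => {vs ks} // vs ks z p IH zx ad.
  move=> i; rewrite size_rcons ltnS leq_eqVlt => /predU1P[->|ivs].
    rewrite nth_rcons (opath_size p) ltnn eqxx -rcons_cons !nth_rcons /=.
    by rewrite ltnSn ltnn eqxx -last_nth.
  rewrite nth_rcons (opath_size p) ivs -rcons_cons !nth_rcons /= !ltnS ivs.
  by rewrite ltnW //; exact: IH.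
move=> h i; rewrite size_rcons ltnS leq_eqVlt => /predU1P[->|ivs].
  rewrite nth_rcons (opath_size p) ltnn eqxx -rcons_cons !nth_rcons /=.
  by rewrite ltnSn ltnn eqxx -last_nth.
rewrite nth_rcons (opath_size p) ivs -rcons_cons !nth_rcons /= !ltnS ivs.
by rewrite ltnW //; exact: IH.
Qed.

Lemma opath_collider vs ks i : opath vs ks -> i.+1 < size vs ->
  nth EBi ks i = EFwd -> nth EBi ks i.+1 = EBwd -> anc C (nth x (x :: vs) i.+1).
Proof.
move=> p; elim: p i => {vs ks} // vs ks z p IH zx ad.
  move=> i; rewrite size_rcons ltnS leq_eqVlt => /predU1P[ivs _|ivs].
    by rewrite nth_rcons ivs (opath_size p) ltnn eqxx.
  rewrite !nth_rcons (opath_size p) ivs (ltnW ivs) -rcons_cons nth_rcons /= ltnS.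
  by rewrite (ltnW ivs); exact: IH.
move=> h i; rewrite size_rcons ltnS leq_eqVlt => /predU1P[ivs|ivs].
  rewrite !nth_rcons (opath_size p) -ivs ltnSn -rcons_cons nth_rcons /=.
  rewrite ivs ltnSn => ki _; move: h; rewrite (last_nth x) -ivs /=; apply.
  rewrite /arrow_in (last_nth EBwd) (opath_size p) -ivs /=.
  by rewrite (set_nth_default EBi) ?ki // (opath_size p) -ivs.
rewrite !nth_rcons (opath_size p) ivs (ltnW ivs) -rcons_cons nth_rcons /= ltnS.
by rewrite (ltnW ivs); exact: IH.
Qed.

(** Admissibility of the edges excludes condition (3) and [opath_collider] excludes condition (2).
    Any [bi] will do, since the path uses directed edges only. *)
Lemma opath_open bi vs ks : opath vs ks -> x \notin C -> last x vs \notin C ->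
  mpath dir bi x vs ks /\ ~ sigma_blocked dir C x vs ks.
Proof.
move=> p xC lC; split.
  split; [exact: opath_uniq p|exact: opath_size p|].
  move=> i /(opath_edge p).
  by case: (nth EBi ks i) => //= -[].
case=> [[]|[[|i] [//= _ iv na hd hd']]|[i [iv iC]]].
- exact/negP.
- exact/negP.
- apply: na; have := opath_edge p iv; have := opath_edge p (ltnW iv).
  have := opath_collider p iv.
  move: hd hd'; case: (nth EBi ks i) => //; case: (nth EBi ks i.+1) => //.
  by move=> _ _ /(_ erefl erefl).
- case=> [[iv' [ki]]|[]].
    by have := opath_edge p iv'; rewrite ki => -[_ _ _ /(_ iC)].
  case: i iv iC => // i /= iv iC _ [ki].
  by have := opath_edge p iv; rewrite ki => -[_ _ _ /(_ iC)].
Qed.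

End ToPath.

Lemma sigma_separated_walk bi A B C : sigma_separated dir bi A B C ->
  walk_separated [set: N] A B C.
Proof.
move=> sep x y b /setDP[xA xC] /setDP[yB yC] /owalk_opath[vs [ks [p l _]]].
have [mp] : mpath dir bi x vs ks /\ ~ sigma_blocked dir C x vs ks.
  by apply: opath_open => //; rewrite l.
by apply; apply: sep mp _; left; rewrite l.
Qed.

End OpenWalks.

(** * The graphical induction *)

Section SccInduction.
Variables (N : finType) (dir : N -> N -> Prop).
Implicit Types (U A B C S : {set N}) (x y z s t : N).

Local Notation dreach := (dreach dir).
Local Notation anc := (anc dir).
Local Notation same_sc := (same_sc dir).

Definition strong_comp s : {set N} := [set t | `[< same_sc s t >]].

Definition outer_parents S : {set N} :=
  [set p | (p \notin S) && `[< exists2 t, t \in S & dir p t >]].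

Definition parent_closed U := forall x y, y \in U -> dir x y -> x \in U.

Lemma strong_compP s t : reflect (same_sc s t) (t \in strong_comp s).
Proof. by rewrite inE; exact: asboolP. Qed.

Lemma outer_parentsP S p :
  reflect (p \notin S /\ exists2 t, t \in S & dir p t) (p \in outer_parents S).
Proof. by rewrite inE; apply: (iffP andP) => -[pS /asboolP]. Qed.

Lemma strong_comp_refl s : s \in strong_comp s.
Proof. by apply/strong_compP; split; exact: dreach_refl. Qed.

Lemma strong_comp_conn s x y :
  x \in strong_comp s -> y \in strong_comp s -> same_sc x y.
Proof.
by move=> /strong_compP[sx xs] /strong_compP[sy ys]; split;
  [exact: dreach_trans sy|exact: dreach_trans sx].
Qed.

Lemma parent_closed_reach U x y : parent_closed U -> y \in U -> dreach x y -> x \in U.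
Proof.
move=> cU + xy; elim: xy => {x y} [x y xy yU|//|x y z _ IH1 _ IH2 /IH2/IH1//].
exact: cU xy.
Qed.

Lemma strong_comp_sub U s : parent_closed U -> s \in U -> strong_comp s \subset U.
Proof.
move=> cU sU; apply/subsetP => t /strong_compP[_ ts].
exact: parent_closed_reach ts.
Qed.

Lemma outer_parents_sub U s : parent_closed U -> s \in U ->
  outer_parents (strong_comp s) \subset U :\: strong_comp s.
Proof.
move=> cU sU; apply/subsetP => p /outer_parentsP[pS [t tS pt]].
by rewrite inE pS; apply: (cU p t _ pt); exact: (subsetP (strong_comp_sub cU sU)).
Qed.

(* A vertex of [U] with the most ancestors lies in a component without *)
(* outgoing edges inside [U].                                          *)
Lemma sink_comp U : parent_closed U -> U != set0 ->
  exists2 s, s \in U & parent_closed (U :\: strong_comp s).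
Proof.
move=> cU /set0Pn[s0 s0U].
pose A s : {set N} := [set t | `[< dreach t s >]].
case: (@arg_maxnP _ s0 (mem U) (fun s => #|A s|) s0U) => s sU smax.
exists s => // x y /setDP[yU yS] xy; rewrite inE (cU _ _ yU xy) andbT.
apply: contra yS => /strong_compP[sx xs].
have sy : dreach s y by apply: dreach_trans sx _; exact: dreach_edge.
apply/strong_compP; split=> //.
have AsAy : A s \subset A y.
  apply/subsetP => t; rewrite !inE => /asboolP ts; apply/asboolP.
  exact: dreach_trans sy.
have /eqP AsE : A s == A y by rewrite eqEcard AsAy; exact: smax.
have : y \in A s by rewrite AsE inE; apply/asboolP; exact: dreach_refl.
by rewrite inE => /asboolP.
Qed.

Lemma parent_closed_ind (Q : {set N} -> Prop) : Q set0 ->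
  (forall U s, parent_closed U -> s \in U ->
     parent_closed (U :\: strong_comp s) -> Q (U :\: strong_comp s) -> Q U) ->
  forall U, parent_closed U -> Q U.
Proof.
move=> Q0 QS U; have [n] := ubnP #|U|; elim: n U => // n IH U Un cU.
have [->//|/(sink_comp cU)[s sU cUs]] := eqVneq U set0.
apply: (QS _ s) => //; apply: IH => //.
rewrite ltnS in Un; apply: leq_trans Un; apply: proper_card.
apply/properP; split; first exact: subsetDl.
by exists s => //; rewrite inE strong_comp_refl.
Qed.

(** Forward edges create no collider at their tails and, inside one component, are admissible even
    at vertices of [C]. *)
Lemma owalk_in_scc U C z x y b : parent_closed U -> x \in U ->
  same_sc x y -> owalk dir U C z x b -> exists b', owalk dir U C z y b'.
Proof.
move=> cU xU [+ yx] zx => /clos_rt_rtn1_iff xy.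
have : exists b', owalk dir U C z x b' by exists b.
elim: xy yx => {y} // t u tu /clos_rt_rtn1_iff xt IH ux zx'.
have ut : dreach u t by exact: dreach_trans ux xt.
have [b' zt] := IH (dreach_trans (dreach_edge tu) ux) zx'.
exists true; apply: ow_fwd zt _; split=> //.
- exact: parent_closed_reach cU xU (dreach_trans (dreach_edge tu) ux).
- exact: parent_closed_reach cU xU ux.
- by split=> //; exact: dreach_edge.
Qed.

(** The edge out of [p] leaves the component of [p], which is allowed because [p] is outside [C];
    its head then reaches [s] inside the component. *)
Lemma parent_entry U C s p z b : parent_closed U -> s \in U -> p \notin C ->
  p \in outer_parents (strong_comp s) -> owalk dir U C z p b ->
  exists b', owalk dir U C z s b'.
Proof.
move=> cU sU pC /outer_parentsP[pS [t tS pt]] zp.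
have tU : t \in U by exact: (subsetP (strong_comp_sub cU sU)).
apply: (@owalk_in_scc _ _ _ t _ true) => //.
  exact: strong_comp_conn (strong_comp_refl s).
apply: ow_fwd zp _; split=> //; [exact: cU tU pt|by rewrite (negbTE pC)].
Qed.

End SccInduction.

(** * The Markov property for an abstract conditional independence relation *)

Section AbstractMarkov.
Variables (N : finType) (dir : N -> N -> Prop) (W : {set N}).
Implicit Types (U A B C S : {set N}) (x y z s t w : N).

Local Notation sc := (strong_comp dir).
Local Notation pa := (outer_parents dir).
Local Notation sep := (walk_separated dir).
Local Notation closed := (parent_closed dir).

(** Besides graphoid rules, two hypotheses describe how a component enters the law: [ci_noise] for
    fresh noise outside a parent-closed set, [ci_det] for a component determined by its outer
    parents. *)
Variable ci : {set N} -> {set N} -> {set N} -> Prop.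
Hypothesis ci_sym : forall A B C, ci A B C -> ci B A C.
Hypothesis ci_mono : forall A A' B B' C, ci A B C ->
  A' \subset A :|: C -> B' \subset B :|: C -> ci A' B' C.
Hypothesis ci_weak_union : forall A B C C', ci A B C ->
  C' \subset B :|: C -> ci A B (C :|: C').
Hypothesis ci_trivial : forall A B C, A \subset C -> ci A B C.
Hypothesis ci_noise : forall U A B C w, closed U -> A :|: B :|: C \subset U ->
  w \in W -> w \notin U -> ci A B C -> ci A (w |: B) C.
Hypothesis ci_det : forall A B C s, s \notin W ->
  ci A (B :|: pa (sc s)) C -> ci A (B :|: sc s) C.
Hypothesis no_parent : forall x w, w \in W -> ~ dir x w.

Let setD_setU A B : A \subset (A :\: B) :|: B.
Proof. by apply/subsetP => x xA; rewrite !inE xA andbT orNb. Qed.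

Lemma source_reach w t : w \in W -> dreach dir t w -> t = w.
Proof.
move=> wW /clos_rt_rtn1_iff tw; case: tw wW => // u v uv _ vW.
by have := no_parent vW uv.
Qed.

Lemma source_comp w : w \in W -> sc w = [set w].
Proof.
move=> wW; apply/setP => t; rewrite [RHS]inE; apply/idP/eqP => [|->]; last first.
  exact: strong_comp_refl.
by move=> /strong_compP[_ /(source_reach wW)].
Qed.

Section Step.
Variables (U : {set N}) (s : N).
Hypotheses (cU : closed U) (sU : s \in U) (cU' : closed (U :\: sc s)).
Hypothesis IH : forall A B C, A \subset U :\: sc s -> B \subset U :\: sc s ->
  C \subset U :\: sc s -> sep (U :\: sc s) A B C -> ci A B C.

Let sub' A : A \subset U -> A :\: sc s \subset U :\: sc s.
Proof. by move=> AU; exact: setSD. Qed.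

(** Walks avoiding the component do not see the conditioning vertices in it. *)
Let sep' A B C : sep U A B C ->
  sep (U :\: sc s) (A :\: sc s) (B :\: sc s) (C :\: sc s).
Proof.
move=> H x y b /setDP[/setDP[xA xS] xC] /setDP[/setDP[yB yS] yC] xy.
rewrite inE xS /= in xC; rewrite inE yS /= in yC.
apply: (H x y b); rewrite ?inE ?xC ?yC //.
apply: owalk_mono xy; [exact: subsetDl|exact: subsetDl|].
by apply/subsetP => z; rewrite !inE => /andP[-> /andP[->]].
Qed.

(** The noise vertex [s] is first adjoined to one side. If [s] is in [C], weak union moves it there;
    otherwise the empty walk shows that [s] lies in at most one of [A] and [B], which decides the
    side. *)
Lemma source_step A B C : s \in W -> A \subset U -> B \subset U -> C \subset U ->
  sep U A B C -> ci A B C.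
Proof.
move=> sW AU BU CU H.
have Sx (X : {set N}) : X \subset (s |: (X :\: sc s)).
  by rewrite (source_comp sW) setUC; exact: setD_setU.
have sUs : s \notin U :\: sc s by rewrite inE strong_comp_refl.
have cl A' B' C' : A' \subset U -> B' \subset U -> C' \subset U ->
    A' :\: sc s :|: B' :\: sc s :|: C' :\: sc s \subset U :\: sc s.
  by move=> *; rewrite !subUset !sub'.
have ciB : forall A B, A \subset U -> B \subset U -> sep U A B C ->
    ci (A :\: sc s) (s |: (B :\: sc s)) (C :\: sc s).
  move=> A' B' A'U B'U H'; apply: (ci_noise cU') => //; first exact: cl.
  by apply: IH; rewrite ?sub' //; exact: sep'.
have [sC|sC] := boolP (s \in C).
  have CE : C = (C :\: sc s) :|: [set s].
    by rewrite (source_comp sW) setUC setD1K.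
  rewrite CE.
  apply: ci_mono (ci_weak_union (ciB _ _ AU BU H) _) _ _.
  - by rewrite sub1set !inE eqxx.
  - rewrite setUCA; apply: subset_trans (Sx A) _.
    by apply/subsetP => z; rewrite !inE => /orP[->|->]; rewrite ?orbT.
  - by apply: subset_trans (Sx B) _; exact: subsetUl.
have CE : C :\: sc s = C.
  by apply/setDidPl; rewrite (source_comp sW) disjoint_sym disjoints1.
have SX (X : {set N}) : s \notin X -> X \subset (X :\: sc s) :|: C.
  move=> sX; rewrite (_ : X :\: sc s = X) ?subsetUl //.
  by apply/setDidPl; rewrite (source_comp sW) disjoint_sym disjoints1.
have [sA|sA] := boolP (s \in A); last first.
  have := ciB _ _ AU BU H; rewrite CE => /ci_mono; apply; first exact: SX.
  by apply: subset_trans (Sx B) _; exact: subsetUl.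
have sB : s \notin B.
  apply/negP => sB; apply: (H s s false); rewrite ?inE ?sC //; exact: ow_nil.
have := ciB _ _ BU AU (walk_separated_sym H); rewrite CE => /ci_sym/ci_mono.
apply; last exact: SX.
by apply: subset_trans (Sx A) _; exact: subsetUl.
Qed.

Lemma det_step A B C : s \notin W -> A \subset U -> B \subset U -> C \subset U ->
  sep U A B C -> ci A B C.
Proof.
move=> sW.
have paU : pa (sc s) \subset U :\: sc s by exact: outer_parents_sub.
have scU : sc s \subset U by exact: strong_comp_sub.
move=> AU BU CU H.
have [S0|/set0Pn[c]] := eqVneq (sc s :&: C) set0; last first.
  rewrite inE => /andP[cS cC].
  (* [good A B] says that the parents of the component can be adjoined to the side of [B]. *)
  pose good A B := A :&: sc s \subset C /\
    sep (U :\: sc s) (A :\: sc s :\: C) (B :\: sc s :\: C :|: pa (sc s)) (C :\: sc s).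
  (* Below the component [IH] applies; [ci_det] trades the parents for the component, and weak union
     then restores the part of [C] inside it. *)
  have goodci : forall A B, A \subset U -> B \subset U -> good A B -> ci A B C.
    move=> A' B' AU' BU' [AS sep1].
    have ci1 := IH (subset_trans (subsetDl _ _) (sub' AU')) _ (sub' CU) sep1.
    have {}ci1 := ci1 _; rewrite subUset paU andbT in ci1.
    have /(ci_det sW) ci2 := ci1 (subset_trans (subsetDl _ _) (sub' BU')).
    have /ci_weak_union ci3 := ci2; have := ci3 (C :&: sc s) _.
    rewrite (setUC (C :\: sc s)) setID; move=> /(_ _) ci4; apply: ci_mono (ci4 _) _ _.
    - by apply/subsetP => z; rewrite !inE => /andP[_ ->]; rewrite orbT.
    - apply/subsetP => z zA; rewrite !(in_setU, in_setD) zA andbT orbC .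
      have [//|/= zC] := boolP (z \in C); apply: contra zC => zS.
      by apply: (subsetP AS); rewrite in_setI zA.
    - by apply/subsetP => z zB; rewrite !(in_setU, in_setD) zB; case: (z \in C);
        case: (z \in sc s); rewrite ?orbT.
  (* Failure means that [A] meets the component outside [C] or has an open walk to one of its
     parents; either way the walk extends to [c]. *)
  have bad : forall A B, A \subset U -> B \subset U -> sep U A B C -> ~ good A B ->
      exists x b, x \in A :\: C /\ owalk dir U C x c b.
    move=> A' B' AU' BU' H' ng.
    have reach x b : owalk dir U C x s b -> exists b', owalk dir U C x c b'.
      apply: owalk_in_scc => //; exact/strong_compP.
    apply: contrapT => no; apply: ng; split.
      apply/subsetP => x; rewrite inE => /andP[xA xS]; apply: contrapT => /negP xC.
      have [b' xs] : exists b', owalk dir U C x c b'.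
        apply: (@owalk_in_scc _ _ _ _ _ x _ false) => //; last exact: ow_nil.
          exact: (subsetP AU').
        exact: strong_comp_conn cS.
      by apply: no; exists x, b'; rewrite inE xC.
    move=> x y b /setDP[/setDP[/setDP[xA xS] xC] _] /setDP[+ yC] xy.
    have {}xy : owalk dir U C x y b.
      apply: owalk_mono xy; [exact: subsetDl|exact: subsetDl|].
      by apply/subsetP => z; rewrite !inE => /andP[-> /andP[->]].
    rewrite inE => /orP[/setDP[/setDP[yB yS] {}yC]|yP].
      by apply: (H' x y b); rewrite ?inE ?xC ?yC.
    have yC' : y \notin C.
      by move: (subsetP paU _ yP) yC; rewrite !inE => /andP[-> _].
    have [b' /reach[b'' xc]] := parent_entry cU sU yC' yP xy.
    by apply: no; exists x, b''; rewrite inE xC.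
  have [|nAB] := pselect (good A B); first exact: goodci.
  have [|nBA] := pselect (good B A); first by move=> /goodci ?; apply: ci_sym; auto.
  have [x [b [xA xc]]] := bad _ _ AU BU H nAB.
  have [y [b' [yB yc]]] := bad _ _ BU AU (walk_separated_sym H) nBA.
  (* If both orders fail, the two walks join at [c], where a collider is open since [c] is in
     [C]. *)
  have [|b'' xy] := owalk_join xc yc.
    by move=> _; exists c => //; exact: dreach_refl.
  by have := H _ _ _ xA yB xy.
have CE : C :\: sc s = C.
  by apply/setDidPl; rewrite disjoint_sym -setI_eq0 S0.
have CU' : C \subset U :\: sc s by rewrite -CE; exact: sub'.
have SnC x : x \in sc s -> x \notin C.
  move=> xS; apply/negP => xC; have : x \in sc s :&: C by rewrite in_setI xS.
  by rewrite S0 in_set0.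
have main : forall A B, A \subset U -> B \subset U -> sep U A B C ->
    B :&: sc s = set0 -> ci A B C.
  move=> A' B' AU' BU' H' BS.
  have BE : B' :\: sc s = B' by apply/setDidPl; rewrite -setI_eq0 BS.
  have BU'' : B' \subset U :\: sc s by rewrite -BE; exact: sub'.
  have [AS|/set0Pn[a]] := eqVneq (A' :&: sc s) set0.
    have AE : A' :\: sc s = A' by apply/setDidPl; rewrite -setI_eq0 AS.
    apply: IH => //; first by rewrite -AE; exact: sub'.
    by rewrite -AE -BE -CE; exact: sep'.
  rewrite inE => /andP[aA aS].
  (* An open walk between [B'] and a parent of the component would extend to [a], so the parents can
     stand in for the component until [ci_det] brings it back. *)
  have : ci B' (A' :\: sc s :|: pa (sc s)) C.
    apply: IH => //; first by rewrite subUset sub'.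
    apply: walk_separated_sym => x y b /setDP[+ xC] /setDP[yB yC] xy.
    have {}xy : owalk dir U C x y b.
      apply: owalk_mono xy; [exact: subsetDl|exact: subxx|exact: subsetIl].
    rewrite inE => /orP[/setDP[xA xS]|xP].
      by apply: (H' x y b); rewrite ?inE ?xC ?yC.
    have [b1 yx] := owalk_sym xy.
    have [b2 ys] := parent_entry cU sU xC xP yx.
    have [b3 ya] : exists b', owalk dir U C y a b'.
      by apply: owalk_in_scc ys => //; exact/strong_compP.
    have [b4 ay] := owalk_sym ya.
    by apply: (H' a y b4) => //; rewrite inE ?yC // SnC.
  move=> /(ci_det sW)/ci_sym/ci_mono; apply; last exact: subsetUl.
  by apply: subset_trans (setD_setU _ (sc s)) _; exact: subsetUl.
have [BS|/set0Pn[b0 b0S]] := eqVneq (B :&: sc s) set0; first exact: main.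
have [AS|/set0Pn[a0 a0S]] := eqVneq (A :&: sc s) set0.
  by apply: ci_sym; apply: main => //; exact: walk_separated_sym.
move: a0S b0S; rewrite !in_setI => /andP[aA aS] /andP[bB bS].
(* If both sets meet the component, a walk inside it contradicts separation. *)
have [b ab] : exists b', owalk dir U C a0 b0 b'.
  apply: (@owalk_in_scc _ _ _ _ _ a0 _ false) => //; last exact: ow_nil.
    exact: (subsetP AU).
  exact: strong_comp_conn bS.
have [] // := H a0 b0 b; by rewrite in_setD SnC.
Qed.

End Step.

Theorem walk_separated_ci A B C : sep [set: N] A B C -> ci A B C.
Proof.
(* Walks are confined to a parent-closed [U] so that sink components can be removed one at a
   time. *)
suff H U : closed U -> forall A B C, A \subset U -> B \subset U ->
    C \subset U -> sep U A B C -> ci A B C.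
  by apply: (H [set: N]); rewrite ?subsetT // => x y; rewrite !inE.
elim/parent_closed_ind: U / => [A' B' C'|U s cU sU cU' IH A' B' C' AU BU CU sepABC].
  by rewrite subset0 => /eqP-> _ _ _; apply: ci_trivial; exact: sub0set.
have [sW|sW] := boolP (s \in W).
  exact: (source_step cU' IH).
exact: (det_step cU sU IH).
Qed.

End AbstractMarkov.

(* Required only here: these libraries shadow the [finset] names used above. *)
From mathcomp Require Import all_classical all_reals all_analysis.
From mathcomp Require Import measurable_realfun.
Import Order.TTheory GRing.Theory Num.Theory.
Import numFieldNormedType.Exports.
Local Open Scope classical_set_scope.
Local Open Scope ring_scope.

(** * Conditional probabilities *)

Section UnitIntegrals.
Local Open Scope ereal_scope.
Context d (T : measurableType d) (R : realType) (mu : probability T R).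

Local Notation intg A f := (\int[mu]_(x in A) (f x)%:E).

(** Values in the unit interval keep all integrals finite and cover both indicators and conditional
    probabilities. *)
Definition unit_fun (f : T -> R) :=
  measurable_fun setT f /\ forall x, (0 <= f x <= 1)%R.

Lemma unit_fun_ge0 f x : unit_fun f -> (0 <= f x)%R.
Proof. by case=> _ /(_ x)/andP[]. Qed.

Lemma unit_fun_meas (f : T -> R) (A : set T) :
  unit_fun f -> measurable_fun A (EFin \o f).
Proof. by case=> mf _; apply/measurable_EFinP; exact: measurable_funTS. Qed.

Lemma unit_indic A : measurable A -> unit_fun (\1_A : T -> R).
Proof.
move=> mA; split; first exact: measurable_indic.
by move=> x; rewrite indicE; case: (_ \in _); rewrite ?lexx ?ler01.
Qed.

Lemma unit_funM f g : unit_fun f -> unit_fun g -> unit_fun (f \* g)%R.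
Proof.
move=> [mf f01] [mg g01]; split; first exact: measurable_funM.
move=> x; have /andP[f0 f1] := f01 x; have /andP[g0 g1] := g01 x.
by rewrite mulr_ge0//= mulr_ile1.
Qed.

Lemma integral_unit_ge0 f A : unit_fun f -> 0 <= intg A f.
Proof. by move=> uf; apply: integral_ge0 => x _; rewrite lee_fin unit_fun_ge0. Qed.

Lemma integral_unit_fin f A : unit_fun f -> measurable A -> intg A f \is a fin_num.
Proof.
move=> uf mA; rewrite ge0_fin_numE ?integral_unit_ge0//.
apply: (@le_lt_trans _ _ (\int[mu]_(x in A) 1)); last first.
  by rewrite integral_cst// mul1e ltey_eq fin_num_measure.
apply: ge0_le_integral => //.
- by move=> x _; rewrite lee_fin unit_fun_ge0.
- exact: unit_fun_meas.
- by move=> x _; rewrite lee_fin; case: uf => _ /(_ x)/andP[].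
Qed.

Lemma integral_setI_indic f A B : measurable A -> measurable B ->
  intg (A `&` B) f = intg A (f \* \1_B)%R.
Proof.
move=> mA mB; rewrite integral_mkcondr epatch_indic.
by apply: eq_integral => x _ /=; rewrite EFinM.
Qed.

Lemma integral_indic_setI A B : measurable A -> measurable B ->
  intg A (\1_B : T -> R) = mu (B `&` A).
Proof. by move=> mA mB; exact: integral_indic. Qed.

Definition ae_equal (A B : set T) := {ae mu, forall x, A x <-> B x}.

Lemma ae_equal_integral f A B : unit_fun f -> measurable A -> measurable B ->
  ae_equal A B -> intg A f = intg B f.
Proof.
move=> uf mA mB AB; rewrite -(setTI A) -(setTI B) !integral_setI_indic//.
apply: ge0_ae_eq_integral => //.
- by apply: unit_fun_meas; apply: unit_funM => //; exact: unit_indic.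
- by apply: unit_fun_meas; apply: unit_funM => //; exact: unit_indic.
- move=> x _; rewrite lee_fin; apply: unit_fun_ge0.
  by apply: unit_funM => //; exact: unit_indic.
- move=> x _; rewrite lee_fin; apply: unit_fun_ge0.
  by apply: unit_funM => //; exact: unit_indic.
move: AB; rewrite /ae_equal; apply: filterS => x AB _ /=; rewrite !indicE.
congr ((_ * _)%R%:E).
by rewrite (_ : (x \in A) = (x \in B)) //; apply/idP/idP; rewrite !inE => /AB.
Qed.

Lemma ae_equal_measure A B : measurable A -> measurable B ->
  ae_equal A B -> mu A = mu B.
Proof.
move=> mA mB /(ae_equal_integral (unit_indic measurableT) mA mB).
by rewrite !integral_indic_setI// !setTI.
Qed.

Lemma unit_cst_measure c : measurable c -> unit_fun (cst (fine (mu c)) : T -> R).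
Proof.
move=> mc; split=> // x; rewrite /cst fine_ge0//= -lee_fin fineK ?fin_num_measure//.
exact: probability_le1.
Qed.

Lemma integral_cst_measure c A : measurable c -> measurable A ->
  intg A (cst (fine (mu c))) = mu A * mu c.
Proof.
move=> mc mA; transitivity ((fine (mu c))%:E * mu A).
  by rewrite -(integral_cst mu mA (fine (mu c))%:E).
by rewrite fineK ?fin_num_measure// muleC.
Qed.

End UnitIntegrals.

(** * Measures given by a density *)

Section ImageDensity.
Local Open Scope ereal_scope.
Context d d' (T : measurableType d) (T' : measurableType d') (R : realType).
Variables (mu : probability T R) (p : T -> T') (f : T -> R).
Hypotheses (mp : measurable_fun setT p) (uf : unit_fun f).

(** The image under [p] of the measure with density [f]. The two proofs are arguments so that the
    measure structure can be attached to this term. *)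
Definition image_density of measurable_fun setT p & unit_fun f :=
  fun A : set T' => \int[mu]_(x in p @^-1` A) (f x)%:E.

Local Notation nu := (image_density mp uf).

Let mpre A : measurable A -> measurable (p @^-1` A).
Proof. by move=> mA; rewrite -(setTI (_ @^-1` _)); exact: mp. Qed.

Let nu0 : nu set0 = 0.
Proof. by rewrite /image_density preimage_set0 integral_set0. Qed.

Let nu_ge0 A : 0 <= nu A.
Proof. exact: integral_unit_ge0. Qed.

Let nu_sigma : semi_sigma_additive nu.
Proof.
move=> F mF tF mUF; rewrite /image_density preimage_bigcup.
apply: (@semi_sigma_additive_nng_induced _ _ _ mu (EFin \o f)).
- exact: unit_fun_meas.
- by move=> x; rewrite lee_fin; exact: unit_fun_ge0.
- by move=> n; exact: mpre.
- apply/trivIsetP => /= i j _ _ ij; rewrite -preimage_setI.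
  by move/trivIsetP : tF => /(_ _ _ _ _ ij) ->//; rewrite preimage_set0.
- by rewrite -preimage_bigcup; exact: mpre.
Qed.

HB.instance Definition _ := isMeasure.Build _ _ _ nu nu0 nu_ge0 nu_sigma.

Let nu_fin : fin_num_fun nu.
Proof. by move=> A mA; apply: integral_unit_fin => //; exact: mpre. Qed.

HB.instance Definition _ := Measure_isFinite.Build _ _ _ nu nu_fin.

End ImageDensity.

Section Density.
Local Open Scope ereal_scope.
Context d (T : measurableType d) (R : realType) (mu : probability T R).
Local Notation intg A f := (\int[mu]_(x in A) (f x)%:E).

Lemma measurable_id_fun : measurable_fun setT (fun x : T => x).
Proof. exact: measurable_id. Qed.

(** The Radon-Nikodym derivative of this measure is [f] almost everywhere, so the change of
    variables formula applies. *)
Lemma integral_density f k A (uf : unit_fun f) : unit_fun k -> measurable A ->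
  \int[image_density mu measurable_id_fun uf]_(x in A) (k x)%:E = intg A (k \* f)%R.
Proof.
move=> uk mA; pose nu := image_density mu measurable_id_fun uf.
have numu : nu `<< mu.
  by move=> N N0 E mE EN; apply: null_set_integral => //;
    [exact: unit_fun_meas|exact: N0].
pose g := Radon_Nikodym_SigmaFinite.f nu mu.
have gf : ae_eq mu setT g (EFin \o f).
  apply: integral_ae_eq => //.
  - exact: Radon_Nikodym_SigmaFinite.f_integrable.
  - exact: unit_fun_meas.
  - move=> E _ mE; rewrite -Radon_Nikodym_SigmaFinite.f_integral//.
rewrite -(Radon_Nikodym_SigmaFinite.change_of_variables numu)//; last 2 first.
- by move=> x; rewrite lee_fin unit_fun_ge0.
- exact: unit_fun_meas.
apply: ae_eq_integral => //.
- apply: emeasurable_funM; first exact: unit_fun_meas.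
  apply: measurable_funTS.
  exact: measurable_int (Radon_Nikodym_SigmaFinite.f_integrable numu).
- by apply: unit_fun_meas; exact: unit_funM.
- by apply: filterS gf => x /(_ I) gx _ /=; rewrite EFinM -[(f x)%:E]gx.
Qed.
End Density.

(** * Conditional probability given a sub-sigma-algebra *)

Section SubSigmaAlgebra.
Local Open Scope ereal_scope.
Context d (T : measurableType d) (R : realType) (mu : probability T R).
Variable G : set (set T).
Hypothesis Gm : G `<=` measurable.
Local Notation intg A f := (\int[mu]_(x in A) (f x)%:E).
Local Notation TG := (g_sigma_algebraType G).

Definition unit_measurable (h : T -> R) :=
  (forall B, measurable B -> <<s G >> (h @^-1` B)) /\ forall x, (0 <= h x <= 1)%R.

Lemma sub_sigma_measurable A : <<s G >> A -> measurable A.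
Proof. by move: A; apply: smallest_sub => //; exact: sigma_algebra_measurable. Qed.

Lemma unit_measurable_unit h : unit_measurable h -> unit_fun h.
Proof.
case=> mh h01; split=> // _ B mB; rewrite setTI.
by apply: sub_sigma_measurable; exact: mh.
Qed.

Lemma unit_measurable_sub h : unit_measurable h -> unit_fun (h : TG -> R).
Proof. by case=> mh h01; split=> // _ B mB; rewrite setTI; exact: mh. Qed.

Lemma unit_measurable_indic A : <<s G >> A -> unit_measurable (\1_A).
Proof.
move=> sA; have [m1 h01] := @unit_indic _ TG R A sA.
by split=> // B mB; have := m1 measurableT B mB; rewrite setTI.
Qed.

Lemma unit_measurableM h k :
  unit_measurable h -> unit_measurable k -> unit_measurable (h \* k)%R.
Proof.
move=> /unit_measurable_sub uh /unit_measurable_sub uk.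
have [mhk hk01] := unit_funM uh uk.
by split=> // B mB; have := mhk measurableT B mB; rewrite setTI.
Qed.

Lemma measurable_to_sub : measurable_fun setT (fun x : T => x : TG).
Proof. by move=> _ B mB; rewrite setTI; exact: sub_sigma_measurable. Qed.

(** The two densities define finite measures agreeing on a pi-system that contains the whole
    space. *)
Lemma integral_eq_generated f1 f2 : setI_closed G -> G setT ->
  unit_fun f1 -> unit_fun f2 -> (forall A, G A -> intg A f1 = intg A f2) ->
  forall A, <<s G >> A -> intg A f1 = intg A f2.
Proof.
move=> GI GT u1 u2 G12.
pose m1 := image_density mu (@measurable_id_fun _ T) u1.
pose m2 := image_density mu (@measurable_id_fun _ T) u2.
apply: (@g_sigma_algebra_measure_unique _ _ _ G Gm (fun=> setT) _ _ m1 m2) => //.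
- by rewrite bigcup_const.
- by move=> _; rewrite ltey_eq fin_num_measure.
Qed.

Lemma independent_generated c : setI_closed G -> G setT -> measurable c ->
  (forall A, G A -> mu (A `&` c) = mu A * mu c) ->
  forall A, <<s G >> A -> mu (A `&` c) = mu A * mu c.
Proof.
move=> GI GT mc Gc A sA; have mA := sub_sigma_measurable sA.
rewrite setIC -integral_indic_setI// -integral_cst_measure//.
apply: integral_eq_generated sA => // [||S GS].
- exact: unit_indic.
- exact: unit_cst_measure.
- have mS := Gm GS.
  by rewrite integral_indic_setI// integral_cst_measure// setIC Gc.
Qed.

Lemma integral_sub_density f k A (uf : unit_fun f) : unit_measurable k ->
  <<s G >> A ->
  \int[image_density mu measurable_to_sub uf]_(x in (A : set TG)) (k x)%:E =
  intg A (k \* f)%R.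
Proof.
move=> uk sA; have mA := sub_sigma_measurable sA.
rewrite -(integral_density mu uf (unit_measurable_unit uk) mA).
have := @ge0_integral_pushforward _ _ T TG R _ measurable_to_sub
  (image_density mu (@measurable_id_fun _ T) uf) A (fun x => (k x)%:E) sA.
rewrite /comp preimage_id => <-.
- by apply: eq_measure_integral; [exact: measurable_to_sub|].
- by apply: unit_fun_meas; exact: unit_measurable_sub.
- by move=> x _; rewrite lee_fin; case: uk => _ /(_ x)/andP[].
Qed.

(** Taking out what is known: both densities define the same measure on the sub-sigma-algebra, and
    [k] is integrated against it. *)
Lemma integral_pull_out f1 f2 k : unit_fun f1 -> unit_fun f2 ->
  (forall A, <<s G >> A -> intg A f1 = intg A f2) -> unit_measurable k ->
  forall A, <<s G >> A -> intg A (k \* f1)%R = intg A (k \* f2)%R.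
Proof.
move=> u1 u2 G12 uk A sA.
rewrite -(integral_sub_density u1) // -(integral_sub_density u2) //.
by apply: eq_measure_integral => B sB _; exact: G12.
Qed.

(** The conditional probability is a Radon-Nikodym derivative taken on the sub-sigma-algebra,
    corrected to stay in the unit interval. *)
Lemma ex_cond_prob b : measurable b -> exists h, unit_measurable h /\
  forall A, <<s G >> A -> intg A (\1_b : T -> R) = intg A h.
Proof.
move=> mb.
(* Density 1 yields the restriction of [mu] to the sub-sigma-algebra. *)
have u1 : unit_fun (cst 1%R : T -> R).
  by split=> // x; rewrite /cst ler01 lexx.
pose P := image_density mu measurable_to_sub u1.
have PE A : measurable A -> P A = mu A.
  move=> mA; rewrite /P /image_density /= integral_cst ?mul1e //.
  exact: sub_sigma_measurable.
pose nu (c : set T) (mc : measurable c) :=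
  image_density mu measurable_to_sub (@unit_indic _ T R c mc).
have nuE c mc A : measurable A -> @nu c mc A = mu (c `&` A).
  by move=> mA; apply: integral_indic_setI => //; exact: sub_sigma_measurable.
have nuP c mc : @nu c mc `<< P.
  move=> N N0 E mE EN; apply: null_set_integral.
  - exact: sub_sigma_measurable.
  - by apply: unit_fun_meas; exact: unit_indic.
  - by have := N0 E mE EN; rewrite PE.
pose g c mc := Radon_Nikodym_SigmaFinite.f (@nu c mc) P.
have g0 c mc x : 0 <= @g c mc x.
  exact: (Radon_Nikodym_SigmaFinite.f_ge0 (nuP c mc)).
have gfin c mc x : @g c mc x \is a fin_num.
  exact: (Radon_Nikodym_SigmaFinite.f_fin_num (nuP c mc)).
have gint c mc : P.-integrable setT (@g c mc).
  exact: (Radon_Nikodym_SigmaFinite.f_integrable (nuP c mc)).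
have gE c mc (A : set TG) : measurable A -> mu (c `&` A) = \int[P]_(x in A) @g c mc x.
  move=> mA; rewrite -(nuE c mc A mA).
  exact: (Radon_Nikodym_SigmaFinite.f_integral (nuP c mc) mA).
(* The derivatives for [b] and its complement are nonnegative with sum 1 almost everywhere, which
   bounds the first by 1. *)
have mnb := measurableC mb.
have g1 : ae_eq P setT (g b mb \+ g _ mnb) (cst 1).
  apply: integral_ae_eq => //; first exact: integrableD.
  move=> E _ mE; rewrite integralD//; [|exact: integrableS (gint _ _)..].
  have mE' := sub_sigma_measurable mE.
  rewrite -!gE// integral_cst// mul1e; transitivity (mu E); last exact/esym/PE.
  rewrite [in RHS](_ : E = (b `&` E) `|` (~` b `&` E)).
    rewrite measureU//; [exact: measurableI|exact: measurableI|].
    by rewrite setIACA setICr set0I.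
  by rewrite -setIUl setUCr setTI.
(* Truncation makes the bound hold everywhere and changes the derivative only on a null set. *)
pose h x := Num.min (fine (g b mb x)) 1%R.
have mg : measurable_fun setT (fun x : TG => fine (g b mb x)).
  by apply: measurableT_comp => //; exact: measurable_int (gint _ _).
have uh : unit_measurable h.
  split=> [B mB|x]; last first.
    by rewrite /h le_min ler01 fine_ge0//= ge_min lexx orbT.
  have mh : measurable_fun setT (h : TG -> R) by exact: measurable_minr.
  by have := mh measurableT B mB; rewrite setTI.
exists h; split=> // A sA.
rewrite integral_indic_setI //; last exact: sub_sigma_measurable.
rewrite (gE _ mb) //.
transitivity (\int[P]_(x in (A : set TG)) (h x)%:E).
  apply: ae_eq_integral => //.
  - apply: measurable_funTS; exact: measurable_int (gint _ _).
  - by apply: unit_fun_meas; exact: unit_measurable_sub.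
  move: g1; apply: filterS => x /(_ Logic.I) /= g1 _.
  rewrite /h min_l ?fineK// -lee_fin fineK// -g1.
  by rewrite leeDl.
rewrite (integral_sub_density u1)//; apply: eq_integral => x _ /=.
by rewrite mulr1.
Qed.

End SubSigmaAlgebra.

(** * Conditional independence of families of sigma-algebras *)

Definition generators (T : Type) (V : finType) (G : V -> set (set T)) (U : {set V}) :
  set (set T) := [set S | exists2 v : V, v \in U & G v S].

Section SigmaFamily.
Local Open Scope ereal_scope.
Context d (T : measurableType d) (R : realType) (mu : probability T R).
Variables (V : finType) (G : V -> set (set T)).
Hypothesis Gm : forall v, G v `<=` measurable.
Local Notation intg A f := (\int[mu]_(x in A) (f x)%:E).
Implicit Types (A B C U : {set V}) (v w : V).

Local Notation sig U := <<s (generators G U) >>.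

Lemma generators_sub A B : A \subset B -> generators G A `<=` generators G B.
Proof. by move=> /fintype.subsetP AB S [v vA GS]; exists v => //; exact: AB. Qed.

Lemma sig_sub A B : A \subset B -> sig A `<=` sig B.
Proof. by move=> AB; apply: sub_smallest2r => //; exact: generators_sub. Qed.

Lemma sig_mono A B e : A \subset B -> sig A e -> sig B e.
Proof. by move=> AB; exact: sig_sub. Qed.

Lemma generators_measurable U : generators G U `<=` measurable.
Proof. by move=> S [v _]; exact: Gm. Qed.
Hint Resolve generators_measurable : core.

Lemma sig_measurable U e : sig U e -> measurable e.
Proof. exact: sub_sigma_measurable. Qed.

Lemma sigT U : sig U setT.
Proof. by have := @measurableT _ (g_sigma_algebraType (generators G U)). Qed.

Lemma sigI U e c : sig U e -> sig U c -> sig U (e `&` c).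
Proof. exact: (@measurableI _ (g_sigma_algebraType (generators G U))). Qed.

Definition rectangles A B : set (set T) :=
  [set S | exists e c, [/\ sig A e, sig B c & S = e `&` c]].

Lemma sig_setU A B : sig (A :|: B) `<=` <<s rectangles A B >>.
Proof.
apply: smallest_sub; first exact: smallest_sigma_algebra.
move=> S [v + GS]; rewrite inE => /orP[vA|vB]; apply: sub_sigma_algebra.
  exists S, setT; split; [|exact: sigT|by rewrite setIT].
  by apply: sub_sigma_algebra; exists v.
exists setT, S; split; [exact: sigT| |by rewrite setTI].
by apply: sub_sigma_algebra; exists v.
Qed.

Lemma integral_eq_rectangles A B f1 f2 : unit_fun f1 -> unit_fun f2 ->
  (forall e c, sig A e -> sig B c -> intg (e `&` c) f1 = intg (e `&` c) f2) ->
  forall e, sig (A :|: B) e -> intg e f1 = intg e f2.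
Proof.
move=> u1 u2 H e /sig_setU; apply: integral_eq_generated => //.
- by move=> _ [e' [c [/sig_measurable me /sig_measurable mc ->]]]; exact: measurableI.
- move=> _ _ [e1 [c1 [e1A c1B ->]]] [e2 [c2 [e2A c2B ->]]].
  by exists (e1 `&` e2), (c1 `&` c2); split; [exact: sigI|exact: sigI|exact: setIACA].
- by exists setT, setT; split; [exact: sigT|exact: sigT|rewrite setIT].
- by move=> _ [e' [c [e'A cB ->]]]; exact: H.
Qed.

(** The conditional probability of [a] given [B] and [C] has a version depending on [C] alone. In
    this asymmetric form, changing [B] only changes the events integrated over. *)
Definition cindep A B C := forall a, sig A a -> exists h : T -> R,
  unit_measurable (generators G C) h /\
  forall e, sig (B :|: C) e -> intg e (\1_a : T -> R) = intg e h.

Lemma unit_measurable_mono A B (h : T -> R) : A \subset B ->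
  unit_measurable (generators G A) h -> unit_measurable (generators G B) h.
Proof. by move=> AB [mh h01]; split=> // S /mh; exact: sig_mono. Qed.

Lemma cindep_trivial A B C : A \subset C -> cindep A B C.
Proof.
move=> AC a sa; exists (\1_a : T -> R); split=> //.
by apply: unit_measurable_indic; exact: sig_mono sa.
Qed.

(** First [ha] replaces the indicator of [a]; then [ha], being a function of [C], is pulled out so
    that [hb] can replace the indicator of [b]. *)
Lemma cindep_product A B C a b c (ha hb : T -> R) : sig A a -> sig B b -> sig C c ->
  unit_measurable (generators G C) ha -> unit_measurable (generators G C) hb ->
  (forall e, sig (B :|: C) e -> intg e (\1_a : T -> R) = intg e ha) ->
  (forall e, sig C e -> intg e (\1_b : T -> R) = intg e hb) ->
  mu (a `&` b `&` c) = intg c (ha \* hb)%R.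
Proof.
move=> sa sb sc uha uhb Ha Hb.
have [ma mb mc] := And3 (sig_measurable sa) (sig_measurable sb) (sig_measurable sc).
have uha' := unit_measurable_unit (@generators_measurable C) uha.
have uhb' := unit_measurable_unit (@generators_measurable C) uhb.
rewrite -setIA -integral_indic_setI//; last exact: measurableI.
rewrite Ha; last first.
  by apply: sigI; [apply: sig_mono sb; exact: finset.subsetUl
    |apply: sig_mono sc; exact: finset.subsetUr].
rewrite setIC integral_setI_indic//.
exact: (integral_pull_out (@generators_measurable C) (unit_indic R mb) uhb' Hb uha sc).
Qed.

(** On rectangles both integrals equal that of [ha] times [hb], by the product formula and by
    pulling out [hb]. *)
Lemma cindep_sym A B C : cindep A B C -> cindep B A C.
Proof.
move=> ABC b sb.
have [hb [uhb Hb]] := ex_cond_prob mu (@generators_measurable C) (sig_measurable sb).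
exists hb; split=> //; apply: integral_eq_rectangles.
- exact: unit_indic (sig_measurable sb).
- exact (unit_measurable_unit (@generators_measurable C) uhb).
move=> a c sa sc; have [ha [uha Ha]] := ABC a sa.
have [ma mb mc] := And3 (sig_measurable sa) (sig_measurable sb) (sig_measurable sc).
rewrite integral_indic_setI//; last exact: measurableI.
rewrite setIA (setIC b) (cindep_product sa sb sc uha uhb Ha Hb).
rewrite setIC integral_setI_indic//.
have HaC e : sig C e -> intg e (\1_a : T -> R) = intg e ha.
  by move=> se; apply: Ha; apply: sig_mono se; exact: finset.subsetUr.
rewrite (integral_pull_out (@generators_measurable C) (unit_indic R ma)
  (unit_measurable_unit (@generators_measurable C) uha) HaC uhb sc).
by apply: eq_integral => x _ /=; rewrite mulrC.
Qed.

Lemma cindep_mono A A' B B' C : cindep A B C ->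
  A' \subset A :|: C -> B' \subset B :|: C -> cindep A' B' C.
Proof.
have mono A1 B1 B2 : B2 \subset B1 :|: C -> cindep A1 B1 C -> cindep A1 B2 C.
  move=> B12 H a /H[h [uh Hh]]; exists h; split=> // e se; apply: Hh.
  by apply: sig_mono se; rewrite finset.subUset B12 finset.subsetUr.
by move=> ABC A'A B'B; apply/cindep_sym/(mono _ _ _ A'A)/cindep_sym/(mono _ _ _ B'B).
Qed.

Lemma cindep_weak_union A B C C' : cindep A B C -> C' \subset B :|: C ->
  cindep A B (C :|: C').
Proof.
move=> ABC C'B a /ABC[h [uh Hh]]; exists h; split.
  by apply: unit_measurable_mono uh; exact: finset.subsetUl.
move=> e se; apply: Hh; apply: sig_mono se.
by rewrite !finset.subUset C'B finset.subsetUl finset.subsetUr.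
Qed.

(** The sets almost everywhere equal to a member of [sig B] form a sigma-algebra, so generators
    suffice. *)
Lemma ae_equal_sig A B :
  (forall v, v \in A -> forall S, G v S ->
     exists2 S', sig B S' & ae_equal mu S S') ->
  forall e, sig A e -> exists2 e', sig B e' & ae_equal mu e e'.
Proof.
move=> AB; apply: smallest_sub => [|S [v vA GS]]; last exact: AB GS.
split=> /=.
- exists set0; last by rewrite /ae_equal; apply: aeW.
  exact: (@measurable0 _ (g_sigma_algebraType (generators G B))).
- move=> e [e' se' ee']; exists (~` e').
    exact: (@measurableC _ (g_sigma_algebraType (generators G B))).
  move: ee'; rewrite /ae_equal; apply: filterS => x ee'.
  by split=> [[_ ne] /ee'//|ne]; split=> // /ee'.
move=> e /(_ _)/cid2 H; exists (\bigcup_n (s2val (H n))).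
  apply: (@bigcupT_measurable _ (g_sigma_algebraType (generators G B))) => n.
  exact: s2valP.
have : {ae mu, forall x n, e n x <-> s2val (H n) x}.
  by apply: ae_foralln => n; have := s2valP' (H n).
by rewrite /ae_equal; apply: filterS => x He; split=> -[n _ en]; exists n => //; apply/He.
Qed.

Lemma ae_equal_refl e : ae_equal mu e e. Proof. by rewrite /ae_equal; apply: aeW. Qed.

Lemma ae_equal_trans e1 e2 e3 :
  ae_equal mu e1 e2 -> ae_equal mu e2 e3 -> ae_equal mu e1 e3.
Proof. by rewrite /ae_equal; apply: filterS2 => x -> ->. Qed.

Lemma ae_equal_setI e e' c c' : ae_equal mu e e' -> ae_equal mu c c' ->
  ae_equal mu (e `&` c) (e' `&` c').
Proof. by rewrite /ae_equal; apply: filterS2 => x ee' cc'; rewrite /setI/= ee' cc'. Qed.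

Lemma cindep_determined A B S P C :
  (forall e, sig S e -> exists2 e', sig P e' & ae_equal mu e e') ->
  cindep A (B :|: P) C -> cindep A (B :|: S) C.
Proof.
move=> SP H a sa; have [h [uh Hh]] := H a sa; exists h; split=> // e se.
have gen v : v \in B :|: S :|: C -> forall D, G v D ->
    exists2 D', sig (B :|: P :|: C) D' & ae_equal mu D D'.
  move=> vBSC D GD; have [vS|vS] := boolP (v \in S).
    have [|D' sD' DD'] := SP D; first by apply: sub_sigma_algebra; exists v.
    exists D' => //; apply: sig_mono sD'.
    by apply/fintype.subsetP => u uP; rewrite !inE uP orbT.
  exists D; last exact: ae_equal_refl.
  apply: sub_sigma_algebra; exists v => //; move: vBSC.
  by rewrite !inE (negbTE vS) orbF => /orP[->|->]; rewrite ?orbT.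
have [e' se' ee'] := ae_equal_sig gen se.
have me := sig_measurable se; have me' := sig_measurable se'.
rewrite (ae_equal_integral (unit_indic R (sig_measurable sa)) me me' ee').
have uh' := unit_measurable_unit (@generators_measurable C) uh.
rewrite (ae_equal_integral uh' me me' ee').
exact: Hh.
Qed.

(** On a rectangle whose second side [c] is an event of [w], both integrals split off the factor
    [mu c]. *)
Lemma cindep_noise A B C w :
  (forall e c, sig (A :|: B :|: C) e -> sig [set w]%SET c ->
     mu (e `&` c) = mu e * mu c) ->
  cindep A B C -> cindep A (w |: B)%SET C.
Proof.
move=> ind H a sa; have [h [uh Hh]] := H a sa; exists h; split=> // e.
have uh' := unit_measurable_unit (@generators_measurable C) uh.
have ma := sig_measurable sa.
rewrite -finset.setUA finset.setUC.
apply: integral_eq_rectangles => //; first exact: unit_indic.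
move=> {}e c se sc; have me := sig_measurable se; have mc := sig_measurable sc.
rewrite !integral_setI_indic//.
set U := A :|: B :|: C in ind.
have cU : C \subset U by exact: finset.subsetUr.
have uc := unit_cst_measure mu mc.
have Hc S : sig U S -> intg S (\1_c : T -> R) = intg S (cst (fine (mu c))).
  move=> sS; have mS := sig_measurable sS.
  by rewrite integral_indic_setI// setIC ind// integral_cst_measure.
have eU : sig U e.
  by apply: sig_mono se; rewrite /U -finset.setUA; exact: finset.subsetUr.
have pull k : unit_measurable (generators G U) k ->
    intg e (k \* \1_c)%R = intg e k * mu c.
  move=> uk.
  rewrite (integral_pull_out (@generators_measurable U) (unit_indic R mc) uc Hc uk eU).
  have uk' := unit_measurable_unit (@generators_measurable U) uk.
  under eq_integral do rewrite /= EFinM fineK ?fin_num_measure//.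
  rewrite ge0_integralZr//.
  - exact: unit_fun_meas.
  - by move=> x _; rewrite lee_fin unit_fun_ge0.
rewrite !pull; first by rewrite Hh.
  exact: unit_measurable_mono uh.
apply: unit_measurable_indic; apply: sig_mono sa.
by rewrite /U -finset.setUA finset.subsetUl.
Qed.

End SigmaFamily.

(** * The Markov property for determined components and independent sources *)

Section ComponentMarkov.
Local Open Scope ereal_scope.
Context d (T : measurableType d) (R : realType) (mu : probability T R).
Variables (V : finType) (G : V -> set (set T)) (dir : V -> V -> Prop).
Variable (W : {set V}).
Hypothesis Gm : forall v, G v `<=` measurable.
Implicit Types (A B C U : {set V}) (v w : V).

Local Notation sig U := <<s (generators G U) >>.
Local Notation sc := (strong_comp dir).

Hypothesis source_no_parent : forall x w, w \in W -> ~ dir x w.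
Hypothesis comp_determined : forall s, s \notin W -> forall e, sig (sc s) e ->
  exists2 e', sig (outer_parents dir (sc s)) e' & ae_equal mu e e'.
Hypothesis source_independent : forall w, w \in W -> forall e c,
  sig (W :\ w)%SET e -> sig [set w]%SET c -> mu (e `&` c) = mu e * mu c.

(** Each removed component is either a noise vertex or determined by parents lying earlier in the
    order. *)
Lemma closed_determined U : parent_closed dir U -> forall e, sig U e ->
  exists2 e', sig (U :&: W) e' & ae_equal mu e e'.
Proof.
elim/parent_closed_ind: U / => [|U s cU sU cU' IH] e.
  by exists e; [apply: sig_mono H; exact: finset.sub0set|exact: ae_equal_refl].
apply: ae_equal_sig => v vU S GS.
have IH' e0 : sig (U :\: sc s) e0 ->
    exists2 e', sig (U :&: W) e' & ae_equal mu e0 e'.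
  move=> /IH[e' se' ee']; exists e' => //; apply: sig_mono se'.
  exact/finset.setSI/finset.subsetDl.
have SE B : v \in B -> sig B S by move=> vB; apply: sub_sigma_algebra; exists v.
have [vS|vS] := boolP (v \in sc s); last first.
  by apply: IH'; apply: SE; rewrite finset.in_setD vS.
have [sW|sW] := boolP (s \in W).
  exists S; last exact: ae_equal_refl.
  move: vS; rewrite (source_comp source_no_parent sW) finset.inE => /eqP vs.
  apply: sub_sigma_algebra; exists v => //.
  by rewrite vs finset.inE sU.
have [e1 se1 ee1] := comp_determined sW (SE _ vS).
have [|e2 se2 ee2] := IH' e1.
  by apply: sig_mono se1; exact: outer_parents_sub.
by exists e2 => //; exact: ae_equal_trans ee2.
Qed.

(** Up to a null set, [e] is an event of noise variables other than [w]. *)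
Lemma closed_independent U w : parent_closed dir U -> w \in W -> w \notin U ->
  forall e c, sig U e -> sig [set w]%SET c -> mu (e `&` c) = mu e * mu c.
Proof.
move=> cU wW wU e c se sc; have [e' se' ee'] := closed_determined cU se.
have me := sig_measurable Gm se; have me' := sig_measurable Gm se'.
have mc := sig_measurable Gm sc.
rewrite (ae_equal_measure me me' ee').
rewrite (@ae_equal_measure _ _ _ mu _ (e' `&` c)); first 1 last.
- exact: measurableI.
- exact: measurableI.
- by apply: ae_equal_setI => //; exact: ae_equal_refl.
apply: source_independent wW _ _ _ sc; apply: sig_mono se'.
apply/fintype.subsetP => u /finset.setIP[uU uW].
by rewrite finset.in_setD1 uW andbT; apply: contraNneq wU => <-.
Qed.

Theorem sigma_separated_cindep bi A B C : sigma_separated dir bi A B C ->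
  cindep mu G A B C.
Proof.
move=> /sigma_separated_walk sep.
apply: (@walk_separated_ci _ dir W (cindep mu G)) sep => //.
- exact: cindep_sym.
- exact: cindep_mono.
- exact: cindep_weak_union.
- exact: cindep_trivial.
- move=> U A' B' C' w cU sub wW wU; apply: cindep_noise => // e c se.
  by apply: (closed_independent cU) => //; exact: sig_mono se.
- move=> A' B' C' s sW; apply: cindep_determined => //; exact: comp_determined.
Qed.

End ComponentMarkov.

(** * The marginalized bipartite graph and its components *)

Section BipartiteGraph.
Variables (V F : finType) (Vf : F -> {set V}) (W : {set V}) (M : {set V * F}).
Hypothesis HM : perfect_matching Vf W M.
Implicit Types (x y v w : V) (f : F).

Local Notation E := (GBM Vf M).
Local Notation D := (fun x y : V => mar_dir E (F_nodes V F) (inl x) (inl y)).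

Lemma matching_pred1 f : exists y, forall v, ((v, f) \in M) = (v == y).
Proof.
case: HM => _ _ /(_ f)/mem_card1[y vfE]; exists y => v.
by have := vfE v; rewrite !inE => <-; apply/idP/asboolP.
Qed.

Lemma match_var f : exists y, (y, f) \in M.
Proof. by have [y yE] := matching_pred1 f; exists y; rewrite yE. Qed.

Lemma matching_uniq x y f : (x, f) \in M -> (y, f) \in M -> x = y.
Proof. by have [z zE] := matching_pred1 f; rewrite !zE => /eqP-> /eqP->. Qed.

Lemma matching_in x f : (x, f) \in M -> x \in Vf f /\ x \notin W.
Proof. by case: HM => H _ _ /H/andP. Qed.

(** Edges alternate between variables and constraints, so a path through constraints only has
    exactly one intermediate vertex. *)
Lemma mar_dirP x y : D x y <-> exists2 f, E (inl x) (inr f) & E (inr f) (inl y).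
Proof.
split=> [[q []]|[f xf fy]]; last first.
  exists [:: inr f]; split; last by rewrite /= finset.inE.
  by apply/and3P; split.
case: q => [|[u|f] [|[z|f'] q]] /=; rewrite ?finset.inE ?andbF //.
by move=> /and3P[xf fy _] _; exists f.
Qed.

Lemma mar_dir_W x w : w \in W -> ~ D x w.
Proof.
by move=> wW /mar_dirP[f _ /andP[_ /matching_in[_]]]; rewrite wW.
Qed.

Lemma connect_dreach x y : connect E (inl x) (inl y) <-> dreach D x y.
Proof.
split=> [/connectP[p]|]; last first.
  elim=> {x y} [x y [q [+ _]]|x|x y z _ xy _ yz].
  - by move=> qy; apply/connectP; exists (rcons q (inl y)); rewrite ?last_rcons.
  - exact: connect0.
  - exact: connect_trans yz.
(* Two bipartite edges are consumed per step and form one edge of [D]. *)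
have [n] := ubnP (size p); elim: n p x => // n IH [|[v|f] [|[z|f'] p]] x //=.
- by move=> _ _ [->]; exact: dreach_refl.
- by rewrite ltnS => pn /and3P[xf fz pz] l; apply: dreach_trans (IH p z _ pz l);
    [apply: dreach_edge; apply/mar_dirP; exists f|exact: leq_trans pn].
- by rewrite andbF.
Qed.

Lemma scc_inl s v : (inl v \in scc Vf M (inl s)) = (v \in strong_comp D s).
Proof.
rewrite finset.inE; apply/andP/strong_compP => -[sv vs];
  by split; apply/connect_dreach.
Qed.

(** The only edge out of [f] leads to its match, so every path from [f] back to [s] passes through
    [v]. *)
Lemma scc_match s v f : (v, f) \in M -> inr f \in scc Vf M (inl s) ->
  v \in strong_comp D s.
Proof.
move=> vf; rewrite finset.inE => /andP[sf /connectP[[|[z|//] p] //=]].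
move=> /andP[/andP[_ zf] pz] l; rewrite -scc_inl finset.inE.
rewrite -(matching_uniq zf vf); apply/andP; split.
  apply: connect_trans sf (connect1 _); rewrite /= zf.
  by case: (matching_in zf) => ->.
by apply/connectP; exists p.
Qed.

Lemma SV_ofE s : SV_of M (scc Vf M (inl s)) = strong_comp D s.
Proof.
apply/finset.setP => v; rewrite finset.inE finset.in_setU scc_inl.
apply/orP/idP => [[//|]|]; last by left.
by rewrite finset.inE => /existsP[[u|f]] /andP[]//= fS vf; exact: scc_match fS.
Qed.

Lemma SF_of_match s f y : (y, f) \in M -> f \in SF_of M (scc Vf M (inl s)) ->
  y \in strong_comp D s.
Proof.
move=> yf; rewrite finset.inE finset.in_setU => /orP[|]; first exact: scc_match.
rewrite finset.inE => /existsP[[u|f'] /andP[+ uf]] //.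
by rewrite scc_inl (matching_uniq uf yf).
Qed.

(** A variable [u] of [f] outside the component is not matched to [f], so it points to [f] and
    thence to the match of [f], which lies in the component. *)
Lemma SF_outside s f : f \in SF_of M (scc Vf M (inl s)) ->
  Vf f :\: strong_comp D s \subset outer_parents D (strong_comp D s).
Proof.
move=> fS; apply/fintype.subsetP => u /finset.setDP[uf uS].
have [y yf] := match_var f; have yS := SF_of_match yf fS.
apply/outer_parentsP; split=> //; exists y => //.
apply/mar_dirP; exists f; rewrite /= ?yf ?andbT ?uf /=; last by case: (matching_in yf).
by apply: contra uS => /(matching_uniq yf) <-.
Qed.

End BipartiteGraph.

(** * The law of the solution *)

Section ConfigSpace.
Variables (V : finType) (d : V -> measure_display).
Variable (T : forall v : V, measurableType (d v)).
Implicit Types (U : {set V}) (v w : V).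

Definition coord_events v : set (set (config T)) :=
  [set S | exists2 B : set (T v), measurable B &
    S = (fun x : config T => x v) @^-1` B].

HB.instance Definition _ := Pointed.copy (config T) (forall v, T v).

(** The product sigma-algebra. The sets [generators coord_events U] are, by conversion, the
    generators of [coord_sigma T U]. *)
Definition config_space : measurableType _ :=
  g_sigma_algebraType (generators coord_events [set: V]).

Lemma coord_events_measurable v :
  coord_events v `<=` (measurable : set (set config_space)).
Proof. by move=> S vS; apply: sub_sigma_algebra; exists v. Qed.

Lemma preimage_coord_sigma dO (Omega : measurableType dO) (Z : Omega -> config T) U :
  (forall v, v \in U -> measurable_fun setT (fun o => Z o v)) ->
  forall c, coord_sigma T U c -> measurable (Z @^-1` c).
Proof.
move=> mZ; apply: smallest_sub.
  split=> [|c mc|c mc] /=.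
  - by rewrite preimage_set0.
  - by rewrite setTD preimage_setC; exact: measurableC.
  - by rewrite preimage_bigcup; exact: bigcupT_measurable.
move=> c [v vU [B mB ->]]; have := mZ v vU measurableT B mB.
by rewrite setTI.
Qed.

Lemma coord_sigma1 w c : coord_sigma T [set w]%SET c -> coord_events w c.
Proof.
move: c; apply: smallest_sub => [|S [v]]; last by rewrite finset.inE => /eqP->.
split=> [|c [B mB ->]|c mc].
- by exists set0 => //; rewrite preimage_set0.
- by exists (~` B); [exact: measurableC|rewrite setTD preimage_setC].
have /(_ _)/cid2 H := mc.
exists (\bigcup_n s2val (H n)).
  by apply: bigcupT_measurable => n; have := s2valP (H n).
by rewrite preimage_bigcup; apply: eq_bigcupr => n _; have := s2valP' (H n).
Qed.

Definition box U (B : forall v, set (T v)) : set (config T) :=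
  \bigcap_(v in [set v | v \in U]) ((fun x : config T => x v) @^-1` B v).

Definition boxes U : set (set (config T)) :=
  [set S | exists2 B : forall v, set (T v), (forall v, measurable (B v)) & S = box U B].

Lemma boxesI U : setI_closed (boxes U).
Proof.
move=> _ _ [B mB ->] [B' mB' ->]; exists (fun v => B v `&` B' v).
  by move=> v; exact: measurableI.
rewrite /box -bigcapI; apply: eq_bigcapr => v _; by rewrite preimage_setI.
Qed.

Lemma boxesT U : boxes U setT.
Proof. by exists (fun v => setT) => //; apply/seteqP; split. Qed.

Lemma measurable_dfwith (B : forall v, set (T v)) w (D : set (T w)) :
  (forall v, measurable (B v)) -> measurable D ->
  forall v, measurable (dfwith B w D v).
Proof.
move=> mB mD v; have [<-|wv] := eqVneq w v; first by rewrite dfwithin.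
by rewrite dfwithout.
Qed.

Lemma coord_sigma_boxes U : coord_sigma T U `<=` <<s boxes U >>.
Proof.
apply: smallest_sub; first exact: smallest_sigma_algebra.
move=> S [v vU [B mB ->]]; apply: sub_sigma_algebra.
exists (dfwith (fun u => setT : set (T u)) v B).
  exact: measurable_dfwith.
apply/seteqP; split=> [x xB u uU|x /(_ v vU)] /=; last by rewrite dfwithin.
by have [<-|vu] := eqVneq v u; [rewrite dfwithin|rewrite dfwithout].
Qed.

Lemma box_measurable U B : (forall v, measurable (B v)) ->
  coord_sigma T U (box U B).
Proof.
move=> mB.
apply: (@fin_bigcap_measurable _ (g_sigma_algebraType (generators coord_events U))) => //.
by move=> v vU; apply: sub_sigma_algebra; exists v => //; exists (B v).
Qed.

Lemma coord_sigma_measurable U c : coord_sigma T U c -> measurable (c : set config_space).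
Proof. exact: (@sig_measurable _ config_space _ _ coord_events_measurable). Qed.

End ConfigSpace.

Section SolutionLaw.
Local Open Scope ereal_scope.
Context (R : realType) dO (Omega : measurableType dO) (P : probability Omega R).
Variables (V : finType) (d : V -> measure_display).
Variable (T : forall v : V, measurableType (d v)).
Variables (W : {set V}) (X : forall v, Omega -> T v) (g : forall v, config T -> T v).
Hypothesis HX : forall v, v \in W -> measurable_fun setT (X v).
Hypothesis Hind : mutually_independent P W X.
Hypothesis Hg : forall v, v \notin W -> coord_measurable W (g v).

Local Notation Y := (Xstar W X g).

Lemma Xstar_measurable : measurable_fun setT (Y : Omega -> config_space T).
Proof.
move=> _ c mc; rewrite setTI; move: mc; apply: preimage_coord_sigma => v _.
move=> _ B mB; rewrite setTI /Xstar; have [vW|vW] := boolP (v \in W).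
  by have := HX vW measurableT mB; rewrite setTI.
by have := preimage_coord_sigma HX (Hg vW mB).
Qed.

Definition solution_mfun : {mfun Omega >-> config_space T} :=
  HB.pack (Y : Omega -> config_space T)
    (isMeasurableFun.Build _ _ _ _ _ Xstar_measurable).

Definition law : probability (config_space T) R := distribution P solution_mfun.

(** The null set required under the law is the symmetric difference, whose preimage lies in the
    exceptional set of [P]. *)
Lemma ae_equal_law (e e' : set (config_space T)) : measurable e -> measurable e' ->
  {ae P, forall o, e (Y o) <-> e' (Y o)} -> ae_equal law e e'.
Proof.
move=> me me' [N [mN N0 sub]]; exists ((e `\` e') `|` (e' `\` e)); split.
- by apply: measurableU; exact: measurableD.
- apply: (@subset_measure0 _ _ _ P _ N) => //.
    rewrite -(setTI (_ @^-1` _)); apply: Xstar_measurable => //.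
    by apply: measurableU; exact: measurableD.
  by move=> o eo; apply: sub => /= H; case: eo => -[] /H.
- move=> x /= H; apply: contrapT => nx; apply: H; split=> ex; apply: contrapT => nex;
  apply: nx; [by left|by right].
Qed.

Lemma law_box B : (forall v, measurable (B v)) ->
  law (box W B) = \prod_(v in W) P (X v @^-1` B v).
Proof.
move=> mB; rewrite -Hind => [|v _]; last exact: mB.
congr (P _); apply/seteqP; split=> o oB v vW; have := oB v vW;
  by rewrite /= /Xstar (vW : v \in W).
Qed.

(** Boxes suffice for the first event. Overwriting the side at [w] turns the intersection with an
    event of [w] into a box over [W], where mutual independence gives a product. *)
Lemma law_independent w : w \in W -> forall e c : set (config T),
  coord_sigma T (W :\ w)%SET e -> coord_sigma T [set w]%SET c ->
  law (e `&` c) = law e * law c.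
Proof.
move=> wW e c /coord_sigma_boxes se sc.
have mc := coord_sigma_measurable sc.
apply: (@independent_generated _ (config_space T) R law (boxes (W :\ w)%SET)) se => //.
- by move=> _ [B mB ->]; apply: coord_sigma_measurable; exact: box_measurable.
- exact: boxesI.
- exact: boxesT.
move=> _ [B mB ->]; have [D mD ->] := coord_sigma1 sc.
have boxD (D' : set (T w)) : box W (dfwith B w D') =
    box (W :\ w)%SET B `&` (fun x : config T => x w) @^-1` D'.
  apply/seteqP; split=> [x xB|x [xB xw] v vW] /=.
    split=> [v|]; last by have := xB w wW; rewrite /= dfwithin.
    rewrite /= finset.in_setD1 => /andP[vw vW].
    by have := xB v vW; rewrite /= dfwithout// eq_sym.
  have [<-|wv] := eqVneq w v; first by rewrite dfwithin.
  by rewrite dfwithout//; apply: xB; rewrite /= finset.in_setD1 eq_sym wv.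
have prodD (D' : set (T w)) : measurable D' ->
    law (box (W :\ w)%SET B `&` (fun x : config T => x w) @^-1` D') =
    P (X w @^-1` D') * \prod_(v in W | v != w) P (X v @^-1` B v).
  move=> mD'; rewrite -boxD law_box; last exact: measurable_dfwith.
  rewrite (bigD1 w)//= dfwithin; congr (_ * _).
  by apply: eq_bigr => v /andP[_ vw]; rewrite dfwithout// eq_sym.
have -> : law ((fun x : config T => x w) @^-1` D) = P (X w @^-1` D).
  by congr (P _); apply/seteqP; split=> o; rewrite /= /Xstar wW.
(* The full event at [w] evaluates the law of the smaller box. *)
have := prodD setT measurableT; rewrite preimage_setT setIT preimage_setT.
by rewrite probability_setT mul1e => ->; rewrite prodD// muleC.
Qed.

(** The version for [a] comes from [cindep], the one for [b] from [ex_cond_prob]; [toP] carries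
    integrals from the law back to [P]. *)
Lemma law_cond_indep A B C : cindep law (@coord_events V d T) A B C ->
  cond_indep P Y A B C.
Proof.
move=> ABC a b sa sb; have [ha [uha Ha]] := ABC a sa.
have mE U :=
  @generators_measurable _ (config_space T) _ _ (@coord_events_measurable V d T) U.
have mb := coord_sigma_measurable sb.
have [hb [uhb Hb]] := ex_cond_prob law (mE C) mb.
have HaC c : coord_sigma T C c ->
    \int[law]_(x in c) (\1_a x)%:E = \int[law]_(x in c) (ha x)%:E.
  move=> sc; apply: Ha; apply: (@sig_mono _ (config_space T) _ _ C) sc.
  exact: finset.subsetUr.
have toP (h : config_space T -> R) (c : set (config_space T)) :
    @unit_measurable _ (config_space T) R (generators (@coord_events V d T) C) h ->
    coord_sigma T C c ->
    \int[law]_(x in c) (h x)%:E = \int[P]_(w in Y @^-1` c) (h (Y w))%:E.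
  move=> uh sc; have uh' := unit_measurable_unit (mE C) uh.
  rewrite /law ge0_integral_pushforward//.
  - exact: coord_sigma_measurable sc.
  - exact: unit_fun_meas.
  - by move=> x _; rewrite lee_fin; exact: unit_fun_ge0.
exists ha, hb; split.
- by case: uha.
- by case: uhb.
- by case: uha.
- by case: uhb.
move=> c sc; have mc := coord_sigma_measurable sc.
have ma := coord_sigma_measurable sa.
split.
- by rewrite -toP// -HaC// integral_indic_setI.
- by rewrite -toP// -Hb// integral_indic_setI.
- rewrite (_ : P _ = law (a `&` b `&` c))//.
  rewrite (@cindep_product _ (config_space T) _ _ _ _
    (@coord_events_measurable V d T) A B C _ _ _ ha hb sa sb sc uha uhb Ha Hb).
  by rewrite toP//; apply: unit_measurableM.
Qed.

End SolutionLaw.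

(** * Components of the solution as functions of their parents *)

Theorem theorem18
  (R : realType) (dO : measure_display) (Omega : measurableType dO)
  (P : probability Omega R)
  (V F : finType) (d : V -> measure_display) (T : forall v : V, measurableType (d v))
  (dY : measure_display) (Y : measurableType dY)
  (Vf : F -> {set V}) (W : {set V})
  (X : forall v : V, Omega -> T v)
  (phi : F -> config T -> Y) (c : F -> Y)
  (g : forall v : V, config T -> T v)
  (M : {set V * F})
  (HT : forall v : V, standard_msp R (T v))
  (HY : standard_msp R Y)
  (Hphi : forall f : F, coord_measurable (Vf f) (phi f))
  (HX : forall v : V, v \in W -> measurable_fun setT (X v))
  (Hind : mutually_independent P W X)
  (Hg : is_solution P W X phi c g)
  (HM : perfect_matching Vf W M)
  (HU : forall a : V + F,
          (forall w : V, w \in W -> inl w \notin scc Vf M a) ->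
          uniquely_solvable P Vf W X phi c
            (SF_of M (scc Vf M a)) (SV_of M (scc Vf M a))) :
  forall A B C : {set V},
    sigma_separated
      (fun x y : V => mar_dir (GBM Vf M) (F_nodes V F) (inl x) (inl y))
      (fun x y : V => mar_bi (GBM Vf M) (F_nodes V F) (inl x) (inl y))
      A B C ->
    cond_indep P (Xstar W X g) A B C.
Proof.
move=> A B C sep; have [Hg1 Hg2] := Hg.
pose D := fun x y : V => mar_dir (GBM Vf M) (F_nodes V F) (inl x) (inl y).
apply: (law_cond_indep (HX := HX) (Hg := Hg1)).
apply: (@sigma_separated_cindep _ (config_space T) R _ V (@coord_events V d T)
  D W (@coord_events_measurable V d T) _ _ _ _ A B C sep).
- by move=> x w wW; exact: (mar_dir_W HM).
- move=> s sW; apply: ae_equal_sig => v vS _ [S mS ->].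
  (* A vertex of [W] has no parents, so one in the component of [s] would be [s] itself. *)
  have scW w : w \in W -> inl w \notin scc Vf M (inl s).
    move=> wW; rewrite scc_inl; apply/negP => /strong_compP[sw _].
    have sE := source_reach (mar_dir_W HM) wW sw.
    by move: sW; rewrite sE wW.
  have [_ [h [mh Hh]]] := HU (inl s) scW.
  rewrite (SV_ofE HM) in mh Hh.
  have sh := mh v vS S mS.
  (* The function [h v] reads only variables of the constraints outside the component, and these are
     outer parents by [SF_outside]. *)
  exists (h v @^-1` S).
    apply: (@sig_mono _ (config_space T) _ _ _ _ _ _ sh).
    apply/fintype.subsetP => u /finset.setDP[/finset.bigcupP[f fS uf] uS].
    by apply: (fintype.subsetP (SF_outside HM fS)); rewrite finset.inE uS.
  have sv : coord_sigma T [set v]%SET ((fun x : config T => x v) @^-1` S).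
    by apply: sub_sigma_algebra; exists v; [rewrite finset.inE|exists S].
  apply: ae_equal_law.
  - exact: coord_sigma_measurable sv.
  - exact: coord_sigma_measurable sh.
  have phiY : {ae P, forall o f, phi f (Xstar W X g o) = c f}.
    exact: filter_forall.
  (* Unique solvability is evaluated at the solution, which satisfies all constraints almost surely
     and already agrees with [X] on [W]. *)
  move: Hh phiY; apply: filterS2 => o /(_ (Xstar W X g o)) /=.
  have -> : (fun u => if u \in W then X u o else Xstar W X g o u) = Xstar W X g o.
    by apply/functional_extensionality_dep => u; rewrite /Xstar; case: (u \in W).
  move=> -[+ _] phiY => /(_ (fun f _ => phiY f))/(_ v vS) /= hv.
  have {}hv : Xstar W X g o v = h v (Xstar W X g o).
    by rewrite -hv /Xstar; case: (v \in W).
  by rewrite /preimage/= hv.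
- by move=> w wW e e' se se'; exact: (law_independent HX Hind Hg1 wW se se').
Qed.
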